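(* Let $d\ge 2$, $\beta\in[0,1]$ and $\kappa>0$, and let $d_1:\mathbb{R}\times\mathbb{R}\to\mathbb{R}_+$ be a pseudo-metric on $\mathbb{R}$. Then $\mathrm{SSFG}(\cdot,\cdot;\beta,\kappa)$ is a pseudo-metric on $\mathcal{P}(\mathbb{R}^d)$: for all $\mu,\nu,\xi\in\mathcal{P}(\mathbb{R}^d)$ we have $\mathrm{SSFG}(\mu,\nu;\beta,\kappa)\ge 0$, $\mathrm{SSFG}(\mu,\nu;\beta,\kappa)=\mathrm{SSFG}(\nu,\mu;\beta,\kappa)$, and there is a constant $C'>0$ (independent of $\mu,\nu,\xi$) with $\mathrm{SSFG}(\mu,\xi;\beta,\kappa)\le C'\big[\mathrm{SSFG}(\mu,\nu;\beta,\kappa)+\mathrm{SSFG}(\nu,\xi;\beta,\kappa)\big]$.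
   Context: $\mathcal{P}(\mathbb{R}^d)$ denotes the probability measures on $\mathbb{R}^d$ with finite moments. A pseudo-metric $d_1$ on $\mathbb{R}$ is a function that is non-negative, symmetric, and satisfies $d_1(x,z)\le C[d_1(x,y)+d_1(y,z)]$ for a universal constant $C>0$ and all $x,y,z$. $\mathbb{S}^{d-1}=\{x\in\mathbb{R}^d:\|x\|=1\}$. For $\theta\in\mathbb{S}^{d-1}$, $\theta\sharp\mu$ is the pushforward of $\mu$ under $x\mapsto\theta^\top x$. For probability measures $\rho,\eta$ on $\mathbb{R}$, $\Pi(\rho,\eta)$ is the set of couplings, and the fused Gromov–Wasserstein discrepancy is $D_{fgw}(\rho,\eta;\beta,d_1)=\min_{\pi\in\Pi(\rho,\eta)}\Big\{(1-\beta)\int d_1(s,t)\,d\pi(s,t)+\beta\iint\big[d_1(s,s')-d_1(t,t')\big]^2\,d\pi(s,t)\,d\pi(s',t')\Big\}$. The von Mises–Fisher distribution $\mathrm{vMF}(\cdot\mid\epsilon,\kappa)$ with location $\epsilon\in\mathbb{S}^{d-1}$ and concentration $\kappa\ge0$ has density $C_d(\kappa)\exp(\kappa\epsilon^\top x)$ with respect to the surface measure on $\mathbb{S}^{d-1}$, where $C_d(\kappa)=\kappa^{d/2-1}/\big((2\pi)^{d/2}I_{d/2-1}(\kappa)\big)$ and $I_v$ is the modified Bessel function of the first kind of order $v$. The spherical sliced fused Gromov–Wasserstein discrepancy is $\mathrm{SSFG}(\mu,\nu;\beta,\kappa)=\max_{\epsilon\in\mathbb{S}^{d-1}}\mathbb{E}_{\theta\sim\mathrm{vMF}(\cdot\mid\epsilon,\kappa)}\big[D_{fgw}(\theta\sharp\mu,\theta\sharp\nu;\beta,d_1)\big]$.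 *)

(* Defs.v *)
From HB Require Import structures.
From mathcomp Require Import all_boot all_order all_algebra.
From mathcomp Require Import all_classical all_reals all_analysis.
Set Implicit Arguments. Unset Strict Implicit. Unset Printing Implicit Defensive.
Import Order.TTheory GRing.Theory Num.Theory.
Import numFieldNormedType.Exports.
Local Open Scope classical_set_scope.
Local Open Scope ring_scope.

Section defs.
Variable R : realType.

Definition dotp (d : nat) (x y : d.-tuple R) : R := \sum_(i < d) tnth x i * tnth y i.
Definition enorm (d : nat) (x : d.-tuple R) : R := Num.sqrt (dotp x x).
Definition sphere (d : nat) : set (d.-tuple R) := [set x : d.-tuple R | enorm x = 1].
Arguments sphere : clear implicits.
Definition tscale (d : nat) (t : R) (x : d.-tuple R) : d.-tuple R := [tuple of map (fun a => t * a) x].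

Fixpoint leb_iter (n : nat) : (n.-tuple R -> \bar R) -> \bar R :=
  match n return (n.-tuple R -> \bar R) -> \bar R with
  | 0 => fun F => F [tuple]
  | n.+1 => fun F => (\int[@lebesgue_measure R]_x leb_iter (fun t => F [tuple of x :: t]))%E
  end.

Definition lebesgue_nd (n : nat) (A : set (n.-tuple R)) : \bar R :=
  leb_iter (fun x => (\1_A x)%:E).

Definition surface_measure (d : nat) (A : set (d.-tuple R)) : \bar R :=
  (d%:R%:E * lebesgue_nd [set y | exists (t : R) (x : d.-tuple R),
     (0 < t <= 1)%R /\ (A `&` sphere d) x /\ y = tscale t x])%E.

Definition Gamma (s : R) : R :=
  fine (\int[@lebesgue_measure R]_(t in `]0%R, +oo[%classic) (t `^ (s - 1) * expR (- t))%:E)%E.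

Definition besselI (v x : R) : R :=
  limn (fun n : nat => \sum_(0 <= m < n) ((x / 2) `^ (2 * m%:R + v) / (m`!%:R * Gamma (m%:R + v + 1)))).

Definition vMF_const (d : nat) (kappa : R) : R :=
  kappa `^ (d%:R / 2 - 1) / ((2 * pi) `^ (d%:R / 2) * besselI (d%:R / 2 - 1) kappa).

Definition vMF_expect (d : nat) (eps : d.-tuple R) (kappa : R) (g : d.-tuple R -> \bar R) : \bar R :=
  (\int[@surface_measure d]_(x in sphere d) ((vMF_const d kappa * expR (kappa * dotp eps x))%:E * g x))%E.

Definition finite_moments (d : nat) (mu : probability (d.-tuple R) R) : Prop :=
  forall k : nat, (\int[mu]_x ((enorm x) ^+ k)%:E < +oo)%E.

Definition is_coupling (rho eta : set R -> \bar R) (gam : probability (R * R)%type R) : Prop :=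
  forall A : set R, measurable A -> gam (A `*` setT) = rho A /\ gam (setT `*` A) = eta A.

Definition D_fgw (rho eta : set R -> \bar R) (beta : R) (d1 : R -> R -> R) : \bar R :=
  ereal_inf [set c | exists gam : probability (R * R)%type R, is_coupling rho eta gam /\
    c = ((1 - beta)%:E * \int[gam]_p (d1 p.1 p.2)%:E
         + beta%:E * \int[gam]_p \int[gam]_q ((d1 p.1 q.1 - d1 p.2 q.2) ^+ 2)%:E)%E].

Definition proj_push (d : nat) (theta : d.-tuple R) (mu : set (d.-tuple R) -> \bar R) : set R -> \bar R :=
  pushforward mu (fun x => dotp theta x).

Definition SSFG (d : nat) (mu nu : set (d.-tuple R) -> \bar R) (beta kappa : R) (d1 : R -> R -> R) : \bar R :=
  ereal_sup [set vMF_expect eps kappa (fun theta => D_fgw (proj_push theta mu) (proj_push theta nu) beta d1)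
            | eps in sphere d].

Definition pseudo_metric (d1 : R -> R -> R) : Prop :=
  [/\ forall x y, 0 <= d1 x y, forall x y, d1 x y = d1 y x &
      exists C : R, 0 < C /\ forall x y z, d1 x z <= C * (d1 x y + d1 y z)].
End defs.

(* Main.v *)
(* The integral of a non-negative function is a supremum over simple functions
   below it, and such a lower integral is subadditive only on functions that are
   measurable up to a null set.  As [d1] is merely Borel, the discrepancy
   D(theta) = D_fgw (proj_push theta mu) (proj_push theta nu) need not be Borel in
   theta.  However, all probabilities on R * R are laws of a Borel function
   of (k, v) for a parameter k in the Cantor space and v uniform on [0, 1[, so
   {theta | D(theta) < r} is the projection of a Borel set along k.  Such a
   projection is obtained by Suslin's operation from measurable sets; restricting
   the operation to finitely branching trees approximates it from inside, so it is
   measurable up to a null set.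
   The triangle inequality of D itself comes from gluing two couplings with a common
   marginal: if (t, u) has the law of the second one, then u can be realized as
   G(t, v) with v uniform and independent of t, by Radon-Nikodym densities of the
   events u in C given t, for C in a countable generating family; the constant is
   max C 2, where 2 comes from (a - b)^2 <= 2 (a - c)^2 + 2 (c - b)^2. *)
Require Import Defs.
From HB Require Import structures.
From mathcomp Require Import all_boot all_order all_algebra.
From mathcomp Require Import all_classical all_reals all_analysis.
From mathcomp Require Import measurable_realfun ring lra.
Import Order.TTheory GRing.Theory Num.Theory.
Local Open Scope classical_set_scope.
Local Open Scope ring_scope.
Set Implicit Arguments. Unset Strict Implicit. Unset Printing Implicit Defensive.

(** * Suslin operation and outer measure *)

Section outer_inf.
Context d (T : measurableType d) (R : realType) (mu : {finite_measure set T -> \bar R}).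
Local Open Scope ereal_scope.
Implicit Types (X B : set T).

Definition outer_inf X : \bar R :=
  ereal_inf [set mu B | B in [set B | measurable B /\ X `<=` B]].

Lemma outer_inf_le X B : measurable B -> X `<=` B -> outer_inf X <= mu B.
Proof. by move=> mB XB; apply: ereal_inf_lbound; exists B. Qed.

(** The infimum is attained by intersecting measurable supersets that come within [1 / (n + 1)] of
    it; it is finite because [mu] is. *)
Lemma outer_inf_hull X : exists B, [/\ measurable B, X `<=` B & mu B = outer_inf X].
Proof.
have fin : outer_inf X \is a fin_num.
  rewrite ge0_fin_numE; last by apply: le_ereal_inf_tmp => _ [B _ <-].
  apply: (le_lt_trans (outer_inf_le (B := setT) measurableT _)) => //.
  by rewrite ltey_eq fin_num_measure.
have ex n : exists B, [/\ measurable B, X `<=` B & mu B < outer_inf X + (n.+1%:R^-1)%:E].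
  have e0 : (0 < n.+1%:R^-1 :> R)%R by rewrite invr_gt0 ltr0n.
  have [_ [B [mB XB] <-] lt] := lb_ereal_inf_adherent e0 fin.
  by exists B.
have [F HF] := choice ex.
exists (\bigcap_n F n); split.
- by apply: bigcap_measurable => // n _; have [] := HF n.
- by move=> x Xx n _; have [_ + _] := HF n; exact.
- apply/eqP; rewrite eq_le; apply/andP; split; last first.
    apply: outer_inf_le; first by apply: bigcap_measurable => // n _; have [] := HF n.
    by move=> x Xx n _; have [_ + _] := HF n; exact.
  apply/lee_addgt0Pr => e e0.
  have [n nlt] : exists n, (n.+1%:R^-1 < e)%R.
    by have [n _ /(_ n (leqnn n))] := near_infty_natSinv_lt (PosNum e0); exists n.
  have [mF XF ltF] := HF n.
  apply: (@le_trans _ _ (mu (F n))).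
    apply: le_measure; rewrite ?inE //.
      by apply: bigcap_measurable => // m _; have [] := HF m.
    exact: bigcap_inf.
  apply: (le_trans (ltW ltF)); apply: leeD => //.
  by rewrite lee_fin ltW.
Qed.

Lemma le_outer_inf X Y : X `<=` Y -> outer_inf X <= outer_inf Y.
Proof.
move=> XY; have [B [mB YB <-]] := outer_inf_hull Y.
by apply: outer_inf_le => //; exact: subset_trans YB.
Qed.

(** Continuity from below, for sets that need not be measurable. Replacing [X n] by the intersection
    of the hulls of all later sets keeps the sequence increasing and adds no outer measure, so
    continuity of [mu] applies. *)
Lemma outer_inf_bigcup (X : (set T)^nat) (a : \bar R) :
  {homo X : n m / (n <= m)%N >-> n `<=` m} ->
  a < outer_inf (\bigcup_n X n) -> exists n, a < outer_inf (X n).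
Proof.
move=> ndX aX; apply: contrapT => /forallNP na.
have [H HH] := choice (fun n => outer_inf_hull (X n)).
pose G n := \bigcap_(m >= n) H m.
have mG n : measurable (G n) by apply: bigcap_measurable => [|m _]; [exists n; exact: leqnn|by case: (HH m)].
have ndG : nondecreasing_seq G.
  move=> n m nm; apply/subsetPset => x Gx k /= mk; apply: Gx => /=.
  exact: leq_trans mk.
have XG n : X n `<=` G n.
  move=> x Xx k /= nk; have [_ + _] := HH k; apply.
  exact: ndX Xx.
have Ga n : mu (G n) <= a.
  have [mH _ HE] := HH n.
  apply: (@le_trans _ _ (mu (H n))).
    apply: le_measure; rewrite ?inE // => x; apply; exact: leqnn.
  by rewrite HE leNgt; apply/negP/na.
have mUG : measurable (\bigcup_n G n) by apply: bigcup_measurable.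
have cv := nondecreasing_cvg_mu (mu := mu) mG mUG ndG.
move: aX; rewrite ltNge => /negP; apply.
apply: (le_trans (outer_inf_le mUG _)).
  by apply: subset_bigcup => n _; exact: XG.
rewrite -(cvg_lim _ cv)//.
apply: lime_le; first by apply: cvgP cv.
by apply: nearW.
Qed.

End outer_inf.

(** König's lemma for a finitely branching tree: [P n s] says that the first [n] entries of [s] form
    a node, and [N i] bounds the choices at level [i]. *)
Lemma koenig_bounded (N : nat -> nat) (P : nat -> (nat -> nat) -> Prop) :
  (forall n s t, (forall i, (i < n)%N -> s i = t i) -> P n s -> P n t) ->
  (forall n m s, (n <= m)%N -> P m s -> P n s) ->
  (forall n, exists s, (forall i, (i < n)%N -> (s i <= N i)%N) /\ P n s) ->
  exists s, forall n, P n s.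
Proof.
move=> Pdep Pdec Pex.
(* [Q k s]: the node given by the first [k] entries of [s] has admissible extensions of every
   length. *)
pose Q k s := forall M, (k <= M)%N -> exists t, [/\ forall i, (i < k)%N -> t i = s i,
  forall i, (i < M)%N -> (t i <= N i)%N & P M t].
pose upd (s : nat -> nat) k j i := if i == k then j else s i.
have step k s : Q k s -> exists j, Q k.+1 (upd s k j).
  move=> Qs; apply: contrapT => /forallNP nQ.
  have bad j : exists M, (k.+1 <= M)%N /\ ~ exists t, [/\
      forall i, (i < k.+1)%N -> t i = upd s k j i,
      forall i, (i < M)%N -> (t i <= N i)%N & P M t].
    by have /existsNP[M /not_implyP[kM nt]] := nQ j; exists M.
  have [M HM] := choice bad.
  (* If each child [j] stops extending at some length [M j], an extension of the parent to the
     maximal such length contradicts the choice of [M] for its own entry at [k]. *)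
  pose M0 := (\max_(j < (N k).+1) M j)%N.
  have MM0 j : (j <= N k)%N -> (M j <= M0)%N.
    rewrite -ltnS => jN; exact: (leq_bigmax (F := fun i : 'I_(N k).+1 => M i) (Ordinal jN)).
  have kM0 : (k < M0)%N by apply: leq_trans (MM0 0%N (leq0n _)); have [] := HM 0%N.
  have [t [ts tN Pt]] := Qs M0 (ltnW kM0).
  have tk := tN k kM0.
  have [_] := HM (t k); apply; exists t; split.
  - by move=> i; rewrite ltnS leq_eqVlt /upd => /predU1P[->|ik]; rewrite ?eqxx// ltn_eqF// ts.
  - by move=> i iM; apply: tN; apply: leq_trans iM (MM0 _ tk).
  - exact: Pdec (MM0 _ tk) Pt.
have Q0 : Q 0%N (fun=> 0%N) by move=> M _; have [t [tN Pt]] := Pex M; exists t.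
have step' ks : exists j, Q ks.1 ks.2 -> Q ks.1.+1 (upd ks.2 ks.1 j).
  have [/step[j Qj]|nQ] := pselect (Q ks.1 ks.2); first by exists j.
  by exists 0%N.
have [f Hf] := choice step'.
pose fix F k := if k is k'.+1 then upd (F k') k' (f (k', F k')) else fun=> 0%N.
have QF k : Q k (F k) by elim: k => [//|k IH]; exact: (Hf (k, F k)).
have FE k i : (i < k)%N -> F k i = F i.+1 i.
  elim: k => // k IH; rewrite ltnS leq_eqVlt => /predU1P[->//|ik].
  by rewrite /= {1}/upd ltn_eqF// IH.
exists (fun i => F i.+1 i) => n.
have [t [tF _ Pt]] := QF n n (leqnn n).
by apply: Pdep Pt => i iN; rewrite tF// FE.
Qed.

Section suslin.
Context d (T : measurableType d) (R : realType) (mu : {finite_measure set T -> \bar R}).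
Local Open Scope ereal_scope.

(** Suslin's operation. Whole sequences replace finite words as indices; the lemmas below assume
    that [E n s] depends only on the first [n] entries of [s]. *)
Definition suslin_op (E : nat -> (nat -> nat) -> set T) : set T :=
  [set x | exists s, forall n, E n s x].

(** Bounds [N i] on the entries are chosen one at a time, each so large that the outer measure stays
    above [a]. The bounded branches form a finitely branching tree; its truncations [L k] are
    measurable and decreasing, and by König's lemma their intersection lies in the Suslin set. *)
Lemma suslin_inner_approx (E : nat -> (nat -> nat) -> set T) (a : \bar R) :
  (forall n s, measurable (E n s)) ->
  (forall n s t, (forall i, (i < n)%N -> s i = t i) -> E n s = E n t) ->
  a < outer_inf mu (suslin_op E) ->
  exists L, [/\ measurable L, L `<=` suslin_op E & a <= mu L].
Proof.
move=> mE depE aE.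
pose A k (N : nat -> nat) := [set x | exists s, (forall i, (i < k)%N -> (s i <= N i)%N) /\
  forall n, E n s x].
pose upd (s : nat -> nat) k j i := if i == k then j else s i.
have step (kN : nat * (nat -> nat)) : exists j, a < outer_inf mu (A kN.1 kN.2) ->
    a < outer_inf mu (A kN.1.+1 (upd kN.2 kN.1 j)).
  case: kN => k N /=.
  have [aA|] := pselect (a < outer_inf mu (A k N)); last by exists 0%N.
  suff : exists j, a < outer_inf mu (A k.+1 (upd N k j)) by case=> j ?; exists j.
  (* As the bound [j] on entry [k] grows, the sets increase and cover [A k N]. *)
  apply: outer_inf_bigcup => [i j ij x [s [sN Es]]|].
    exists s; split => // l lk; apply: leq_trans (sN l lk) _.
    by rewrite /upd; case: ifP.
  apply: (lt_le_trans aA); apply: le_outer_inf => x [s [sN Es]].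
  exists (s k) => //; exists s; split => // i; rewrite ltnS /upd.
  by case: eqVneq => [->//|ik]; rewrite leq_eqVlt (negbTE ik) => /sN.
have [f Hf] := choice step.
pose fix F k := if k is k'.+1 then upd (F k') k' (f (k', F k')) else fun=> 0%N.
have aF k : a < outer_inf mu (A k (F k)).
  elim: k => [|k IH]; last exact: (Hf (k, F k)).
  apply: (lt_le_trans aE); apply: le_outer_inf => x [s Es].
  by exists s; split.
have FE k i : (i < k)%N -> F k i = F i.+1 i.
  elim: k => // k IH; rewrite ltnS leq_eqVlt => /predU1P[->//|ik].
  by rewrite /= {1}/upd ltn_eqF// IH.
pose N i := F i.+1 i.
pose L k := [set x | exists s, (forall i, (i < k)%N -> (s i <= N i)%N) /\
  forall n, (n <= k)%N -> E n s x].
have mL k : measurable (L k).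
  (* Only the first [k] entries of [s] matter in [L k], so [s] may range over the countably many
     sequences [S j], which are finite words padded with 0. *)
  pose S j : nat -> nat := nth 0%N (odflt [::] (unpickle j : option (seq nat))).
  rewrite (_ : L k = \bigcup_(j in [set j | forall i, (i < k)%N -> (S j i <= N i)%N])
      \bigcap_(n in [set n | (n <= k)%N]) E n (S j)).
    apply: bigcup_measurable => j _; apply: bigcap_measurable => [|n _]; last exact: mE.
    by exists 0%N.
  apply/seteqP; split => [x [s [sN Es]]|x [j /= jN Ej]]; last by exists (S j).
  have Ss i : (i < k)%N -> S (pickle (mkseq s k)) i = s i.
    by move=> ik; rewrite /S pickleK/= nth_mkseq.
  exists (pickle (mkseq s k)) => /= [i ik|n nk]; first by rewrite Ss// sN.
  rewrite (depE _ _ s); first exact: Es.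
  by move=> i il; apply: Ss; exact: leq_trans il nk.
have ndL : nonincreasing_seq L.
  move=> n m nm; apply/subsetPset => x [s [sN Es]]; exists s; split => i ik.
    by apply: sN; exact: leq_trans ik nm.
  by apply: Es; exact: leq_trans ik nm.
have mIL : measurable (\bigcap_n L n) by apply: bigcap_measurable.
have mu0 : mu (L 0%N) < +oo by rewrite ltey_eq fin_num_measure.
have cv := nonincreasing_cvg_mu (mu := mu) mu0 mL mIL ndL.
exists (\bigcap_n L n); split => // [x Lx|].
  have [||| s Es] := @koenig_bounded N (fun k s => forall n, (n <= k)%N -> E n s x).
  - move=> n s t st Es m mn; rewrite -(depE m s t); first exact: Es.
    by move=> i im; apply: st; exact: leq_trans im mn.
  - by move=> n m s nm Es l ln; apply: Es; exact: leq_trans ln nm.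
  - by move=> n; exact: Lx.
  - by exists s => n; exact: Es (leqnn n).
rewrite -(cvg_lim _ cv)//; apply: lime_ge; first by apply: cvgP cv.
(* [F k] and [N] agree below [k], so [L k] is a measurable set containing [A k (F k)], whose outer
   measure exceeds [a]. *)
apply: nearW => k; apply: (le_trans (ltW (aF k))).
apply: outer_inf_le => // x [s [sF Es]]; exists s; split => // i ik.
by rewrite /N -(FE k)// sF.
Qed.

(** [U] is a measurable hull, and [L] is the union of inner approximations that reach its measure up
    to [1 / (n + 1)]. *)
Lemma suslin_measurable_mod (E : nat -> (nat -> nat) -> set T) :
  (forall n s, measurable (E n s)) ->
  (forall n s t, (forall i, (i < n)%N -> s i = t i) -> E n s = E n t) ->
  exists L U, [/\ measurable L, measurable U, L `<=` suslin_op E,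
    suslin_op E `<=` U & mu (U `\` L) = 0].
Proof.
move=> mE depE; set A := suslin_op E.
have [U [mU AU muU]] := outer_inf_hull mu A.
have finU : mu U \is a fin_num by exact: fin_num_measure.
have ex n : exists L, [/\ measurable L, L `<=` A & mu U - (n.+1%:R^-1)%:E <= mu L].
  apply: suslin_inner_approx => //; rewrite -/A -muU lteBlDr//.
  by rewrite lteDl// lte_fin invr_gt0 ltr0n.
have [F HF] := choice ex.
have mL : measurable (\bigcup_n F n) by apply: bigcup_measurable => n _; case: (HF n).
have LA : \bigcup_n F n `<=` A by apply: bigcup_sub => n _; case: (HF n).
exists (\bigcup_n F n), U; split => //.
rewrite measureD ?ltey_eq ?finU// setIidr; last exact: subset_trans AU.
apply/eqP; rewrite eq_le; apply/andP; split; last first.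
  rewrite sube_ge0 ?finU ?orbT//.
  by apply: le_measure; rewrite ?inE//; exact: subset_trans AU.
apply/lee_addgt0Pr => e e0; rewrite add0e leeBlDr ?fin_num_measure//.
have [n nlt] : exists n, (n.+1%:R^-1 < e)%R.
  by have [n _ /(_ n (leqnn n))] := near_infty_natSinv_lt (PosNum e0); exists n.
have [mF _ leF] := HF n.
rewrite -leeBlDl//.
apply: le_trans (le_trans leF _); last first.
  by apply: le_measure; rewrite ?inE//; exact: bigcup_sup.
by apply: leeB => //; rewrite lee_fin ltW.
Qed.

End suslin.

(** * Projections of measurable sets *)

Definition coordinate_sets : set (set (nat -> bool)) :=
  [set A | exists i b, A = [set k | k i = b]].
Notation bitstream := (g_sigma_algebraType coordinate_sets).

Section suslin_rep.
Context d (T : measurableType d).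

(* [B] is the projection along [s] of a countable intersection of sets whose
   [n]-th member has measurable sections and looks at [n] entries of [k] and [s]. *)
Definition suslin_rep (B : set (T * bitstream)) : Prop :=
  exists E : nat -> (nat -> bool) -> (nat -> nat) -> set T,
  [/\ forall n k s, measurable (E n k s),
      forall n k k' s s', (forall i, (i < n)%N -> k i = k' i) ->
        (forall i, (i < n)%N -> s i = s' i) -> E n k s = E n k' s' &
      forall t k, B (t, k) <-> exists s, forall n, E n k s t].

Lemma suslin_rep_fst (A : set T) : measurable A -> suslin_rep (fst @^-1` A).
Proof.
move=> mA; exists (fun _ _ _ => A); split => // t k.
by split => [|[s /(_ 0%N)]] //; exists (fun=> 0%N).
Qed.

Lemma suslin_rep0 : suslin_rep set0.
Proof. by rewrite -(preimage_set0 fst); exact: suslin_rep_fst. Qed.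

Lemma suslin_repT : suslin_rep setT.
Proof. by rewrite -(preimage_setT fst); exact: suslin_rep_fst. Qed.

(** The entry [s 0] names the member of the union, and the shifted sequence is the witness for that
    member. The shift delays level [n] to [n.+1]; level 0 is vacuous. *)
Lemma suslin_rep_bigcup (B : (set (T * bitstream))^nat) :
  (forall m, suslin_rep (B m)) -> suslin_rep (\bigcup_m B m).
Proof.
move=> /choice[E HE].
exists (fun n k s => if n is n'.+1 then E (s 0%N) n' k (s \o succn) else setT); split.
- by move=> [|n] k s //; have [+ _ _] := HE (s 0%N); exact.
- move=> [|n] k k' s s' kk' ss' //; rewrite -ss'//.
  have [_ + _] := HE (s 0%N); apply => i ilt; first by apply: kk'; exact: ltnW.
  exact: ss'.
- move=> t k; split => [[m _ Bm]|[s Es]].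
    have [_ _ HB] := HE m; have [s Es] := (HB t k).1 Bm.
    by exists (fun i => if i is i'.+1 then s i' else m) => -[|n] //; exact: Es.
  exists (s 0%N) => //; have [_ _ HB] := HE (s 0%N); apply/HB.
  by exists (s \o succn) => n; exact: (Es n.+1).
Qed.

Lemma suslin_rep_bigcap (B : (set (T * bitstream))^nat) :
  (forall m, suslin_rep (B m)) -> suslin_rep (\bigcap_m B m).
Proof.
move=> /choice[E HE].
(* All witnesses are packed into one sequence, the one for [B m] sitting at the places
   [pickle (m, i)]. Level [N] imposes the constraint [(m, n)] only once every entry it reads lies
   below [N]. *)
pose sub (s : nat -> nat) (m i : nat) : nat := s (pickle (m, i)).
pose ok (N m n : nat) := [&& (n <= N)%N & all (fun i => (pickle (m, i) < N)%N) (iota 0 n)].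
exists (fun N k s => \bigcap_(mn in [set mn : nat * nat | ok N mn.1 mn.2])
  E mn.1 mn.2 k (sub s mn.1)); split.
- move=> N k s; rewrite (_ : \bigcap_(_ in _) _ = \bigcap_j (if unpickle j is Some mn then
      if ok N mn.1 mn.2 then E mn.1 mn.2 k (sub s mn.1) else setT else setT)).
    apply: bigcapT_measurable => j; case: unpickle => [[m n]/=|//].
    by case: ifP => // _; have [+ _ _] := HE m; exact.
  apply/seteqP; split => [x Ex j _|x Ex [m n] /= okmn].
    by case: unpickle => [[m n]/=|//]; case: ifPn => // okmn; exact: (Ex (m, n)).
  by have := Ex (pickle (m, n)) I; rewrite pickleK /= okmn.
- move=> N k k' s s' kk' ss'; apply: eq_bigcapr => -[m n] /= /andP[nN /allP okmn].
  have [_ + _] := HE m; apply => i ilt; first by apply: kk'; exact: leq_trans nN.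
  by apply: ss'; apply: okmn; rewrite mem_iota.
- move=> t k; split => [Bt|[s Es] m _].
    have /choice[s Hs] m : exists s, forall n, E m n k s t.
      by have [_ _ HB] := HE m; apply/HB; exact: Bt.
    exists (fun j => if unpickle j is Some (m, i) then s m i else 0%N) => N -[m n] /= _.
    suff -> : sub (fun j => if unpickle j is Some (m, i) then s m i else 0%N) m = s m by exact: Hs.
    by apply/funext => i; rewrite /sub pickleK.
  have [_ _ HB] := HE m; apply/HB; exists (sub s m) => n.
  (* A level late enough for the constraint [(m, n)] to be imposed. *)
  pose N := (n + \max_(i < n) (pickle (m, nat_of_ord i)).+1)%N.
  apply: (Es N (m, n)) => /=; rewrite /ok leq_addr /=.
  apply/allP => i; rewrite mem_iota add0n => /andP[_ ilt].
  rewrite /N; apply: leq_trans (leq_addl _ _).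
  exact: (leq_bigmax (F := fun i : 'I_n => (pickle (m, nat_of_ord i)).+1) (Ordinal ilt)).
Qed.

Lemma suslin_rep_snd i b : suslin_rep (snd @^-1` [set k | k i = b]).
Proof.
(* The bit [i] is tested only from level [i.+1] on, when it may be read. *)
exists (fun n k _ => if (i < n)%N then if k i == b then setT else set0 else setT); split.
- by move=> n k s; case: ifP => // _; case: ifP.
- by move=> n k k' s s' kk' _; case: ifP => // iN; rewrite kk'.
- move=> t k; split => [/= kb|[s /(_ i.+1)]].
    by exists (fun=> 0%N) => n; rewrite kb eqxx; case: ifP.
  by rewrite ltnSn; case: ifP => // /eqP.
Qed.

(** Representability is not evidently stable under complement, so the induction carries [B] together
    with its complement; countable unions and intersections then exchange roles. *)
Lemma measurable_suslin_rep (B : set (T * bitstream)) : measurable B -> suslin_rep B.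
Proof.
suff : (@measurable _ (T * bitstream)%type) `<=` [set B | suslin_rep B /\ suslin_rep (~` B)].
  by move=> /[apply] -[].
apply: smallest_sub; last first.
  move=> _ [] [A mA <-]; rewrite setTI.
    by split; [|rewrite preimage_setC]; apply: suslin_rep_fst => //; exact: measurableC.
  have : [set A : set bitstream | suslin_rep (snd @^-1` A) /\ suslin_rep (~` (snd @^-1` A))] A.
    apply: mA; split.
      split => [|A' []|F HF].
      - by rewrite /= preimage_set0 setC0; split; [exact: suslin_rep0|exact: suslin_repT].
      - by rewrite /= setTD -preimage_setC setCK.
      - rewrite /= preimage_bigcup setC_bigcup; split.
          by apply: suslin_rep_bigcup => m; case: (HF m).
        by apply: suslin_rep_bigcap => m; case: (HF m).
    move=> _ [i [b ->]]; split; first exact: suslin_rep_snd.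
    rewrite preimage_setC (_ : ~` _ = [set k | k i = ~~ b]); first exact: suslin_rep_snd.
    by apply/seteqP; split => k /=; case: (k i) b => -[].
  by [].
split => [|A' []|F HF].
- by rewrite /= setC0; split; [exact: suslin_rep0|exact: suslin_repT].
- by rewrite /= setTD setCK.
- rewrite /= setC_bigcup; split.
    by apply: suslin_rep_bigcup => m; case: (HF m).
  by apply: suslin_rep_bigcap => m; case: (HF m).
Qed.

End suslin_rep.

Lemma projection_measurable_mod d (T : measurableType d) (R : realType)
    (mu : {finite_measure set T -> \bar R}) (B : set (T * bitstream)) :
  measurable B ->
  exists L U, [/\ measurable L, measurable U, L `<=` fst @` B, fst @` B `<=` U & mu (U `\` L) = 0%E].
Proof.
move=> /measurable_suslin_rep [E [mE depE BE]].
(* [t] interleaves both existential variables: the parity of entry [2 i] is the bit [k i], and entry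
   [2 i + 1] is [s i]. Halving the depth makes [E' N] read only entries below [N]. *)
pose E' N (t : nat -> nat) := E N./2 (fun i => odd (t i.*2)) (fun i => t i.*2.+1).
have lt2 i N : (i < N./2)%N -> (i.*2.+1 < N)%N.
  by rewrite gtn_half_double.
have [||L [U [mL mU LE EU LU]]] := suslin_measurable_mod mu (E := E').
- by move=> n s; exact: mE.
- move=> n s t st; apply: depE => i /lt2 iN; last by rewrite st.
  by rewrite st// ltnW.
suff EB : suslin_op E' = fst @` B by exists L, U; rewrite -EB.
apply/seteqP; split => [x [s Es]|_ [[x k] /BE[s Es] <-]].
  exists (x, fun i => odd (s i.*2)) => //; apply/BE.
  by exists (fun i => s i.*2.+1) => n; have := Es n.*2; rewrite /E' doubleK.
exists (fun i => if odd i then s i./2 else nat_of_bool (k i./2)) => n.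
rewrite /E' (_ : (fun i => _) = k); last first.
  by apply/funext => i; rewrite odd_double doubleK; case: (k i).
rewrite (_ : (fun i => _) = s); first exact: Es.
by apply/funext => i; rewrite /= odd_double /= uphalf_double.
Qed.

(** * Integrals of almost measurable functions *)

Section almost_measurable.
Context d (T : measurableType d) (R : realType).
Local Open Scope ereal_scope.

Definition almost_measurable (mu : {measure set T -> \bar R}) (f : T -> \bar R) :=
  exists N, [/\ measurable N, mu N = 0 & measurable_fun (~` N) f].

(** Rational thresholds suffice: off the countable union of the null gaps between inner and outer
    approximations, each set where [f] is below a rational coincides with its inner
    approximation. *)
Lemma projection_almost_measurable (mu : {finite_measure set T -> \bar R}) (f : T -> \bar R) :
  (forall r : R, exists2 B : set (T * bitstream), measurable B &
    [set t | f t < r%:E] = fst @` B) ->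
  almost_measurable mu f.
Proof.
move=> fB.
pose q (n : nat) : R := ratr (odflt 0%R (unpickle n)).
have /choice[L] n : exists LU : set T * set T, [/\ measurable LU.1, measurable LU.2,
    LU.1 `<=` [set t | f t < (q n)%:E], [set t | f t < (q n)%:E] `<=` LU.2
    & mu (LU.2 `\` LU.1) = 0].
  have [B mB ->] := fB (q n).
  by have [L [U ?]] := projection_measurable_mod mu mB; exists (L, U).
move=> HL.
exists (\bigcup_n ((L n).2 `\` (L n).1)).
have mD n : measurable ((L n).2 `\` (L n).1) by case: (HL n) => *; exact: measurableD.
have mN := bigcup_measurable (fun n (_ : setT n) => mD n).
split => //.
  apply: (@measure_negligible _ _ _ mu) => //; apply: negligible_bigcup => n.
  by exists ((L n).2 `\` (L n).1); split => //; case: (HL n).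
move=> mNc; apply: (measurability _ (ErealGenInftyO.measurableE R)) => // _ [_ [r ->] <-].
set N := \bigcup_n _.
rewrite (_ : _ `&` _ = ~` N `&` \bigcup_(n in [set n | (q n < r)%R]) (L n).1).
  apply: measurableI; first exact: measurableC.
  by apply: bigcup_measurable => n _; case: (HL n).
apply/seteqP; split => x [Nx] /=; last first.
  move=> [n /= qr Lx]; split => //; rewrite in_itv /=.
  have [_ _ LA _ _] := HL n.
  by apply: (lt_trans (LA _ Lx)); rewrite lte_fin.
rewrite in_itv /= => fr; split => //.
have [z fz] : exists z : rat, f x < (ratr z)%:E /\ (ratr z < r)%R.
  case: (f x) fr => [s||] //=.
    rewrite lte_fin => /rat_in_itvoo[z]; rewrite in_itv /= => /andP[sz zr].
    by exists z; rewrite lte_fin.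
  move=> _; have /rat_in_itvoo[z] : (r - 1 < r)%R by rewrite ltrBlDr ltrDl.
  by rewrite in_itv /= => /andP[_ zr]; exists z; rewrite ltNyr.
exists (pickle z) => /=; first by rewrite /q pickleK /=; case: fz.
have [_ _ _ + _] := HL (pickle z).
rewrite {1}/q pickleK /= => /(_ x fz.1) Ux.
by apply: contrapT => nL; apply: Nx; exists (pickle z).
Qed.

(** The enlargement [N'] lets several functions be cut off on one common null set. *)
Lemma almost_measurable_patch (mu : {measure set T -> \bar R}) (f : T -> \bar R) :
  almost_measurable mu f ->
  exists N, [/\ measurable N, mu N = 0 & forall N', measurable N' -> N `<=` N' ->
    measurable_fun setT (f \_ (~` N'))].
Proof.
move=> [N [mN muN mf]]; exists N; split => // N' mN' NN'.
apply/(measurable_restrictT _ (measurableC mN')).1.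
apply: measurable_funS mf; first exact: measurableC.
exact: subsetC.
Qed.

Import HBNNSimple.

(* No measurability of [f]: its integral is a supremum over simple functions below it. *)
Lemma ge0_integral_patch_null (mu : {measure set T -> \bar R}) (f : T -> \bar R) N D :
  measurable D -> measurable N -> mu N = 0 ->
  (forall x, 0 <= f x) -> measurable_fun setT (f \_ (~` N)) ->
  \int[mu]_(x in D) f x = \int[mu]_(x in D) (f \_ (~` N)) x.
Proof.
move=> mD mN muN f0 mf.
have fN0 x : 0 <= (f \_ (~` N)) x by rewrite patchE; case: ifP.
have fNf x : (f \_ (~` N)) x <= f x by rewrite patchE; case: ifP.
apply/eqP; rewrite eq_le; apply/andP; split; last first.
  rewrite !ge0_integralE//; apply: le_ereal_sup => _ [h hf <-].
  exists h => // x; apply: (le_trans (hf x)).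
  by rewrite !patchE; case: ifP => // _; exact: fNf.
rewrite [leLHS]ge0_integralE//; apply: ge_ereal_sup => _ [h /= hf <-].
rewrite -integralT_nnsfun.
have mh : measurable_fun setT (EFin \o h) by apply/measurable_EFinP.
have h0 x : 0 <= (h x)%:E by rewrite lee_fin.
rewrite (ge0_negligible_integral mN measurableT mh)//; last by move=> x _; exact: h0.
rewrite setTD [leRHS]integral_mkcond.
have mfD : measurable_fun setT ((f \_ (~` N)) \_ D).
  by apply/(measurable_restrictT _ mD).1; exact: measurable_funTS.
have fD0 x : 0 <= ((f \_ (~` N)) \_ D) x by rewrite patchE; case: ifP.
apply: (@le_trans _ _ (\int[mu]_(x in ~` N) (((f \_ (~` N)) \_ D) x))).
  apply: ge0_le_integral.
  - exact: measurableC.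
  - by move=> x _; exact: h0.
  - exact: measurable_funTS.
  - exact: measurable_funTS.
  - by move=> x Nx; apply: (le_trans (hf x)); rewrite !patchE (mem_set Nx).
apply: ge0_subset_integral => //; exact: measurableC.
Qed.

End almost_measurable.

(** * Coding reals by bit streams *)

Section bitstream_measurability.
Context d (T : measurableType d).

Lemma measurable_coordinate i b : measurable [set k : bitstream | k i = b].
Proof. by apply: sub_sigma_algebra; exists i, b. Qed.

Lemma measurable_fun_bitstream (f : T -> bitstream) :
  (forall i, measurable_fun setT (fun x => f x i)) <-> measurable_fun setT f.
Proof.
split => mf.
  apply: (@measurability _ _ T bitstream setT f coordinate_sets) => //.
  move=> _ [_ [i [b ->]] <-].
  have -> : f @^-1` [set k | k i = b] = (fun x => f x i) @^-1` [set b] by [].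
  exact: mf.
move=> i; apply: (measurable_fun_bool true).
have -> : (fun x => f x i) @^-1` [set true] = f @^-1` [set k | k i = true] by [].
by apply: mf => //; exact: measurable_coordinate.
Qed.

(* Words are read backwards: the head of a word is its last letter. *)
Fixpoint prefix_word (k : nat -> bool) n : seq bool :=
  if n is n'.+1 then k n' :: prefix_word k n' else [::].

Lemma size_prefix_word k n : size (prefix_word k n) = n.
Proof. by elim: n => //= n ->. Qed.

Definition cylinder (w : seq bool) : set bitstream :=
  [set k | prefix_word k (size w) = w].

Lemma cylinder_nil : cylinder [::] = setT.
Proof. by apply/seteqP; split. Qed.

Lemma cylinder_cons b w : cylinder (b :: w) = cylinder w `&` [set k | k (size w) = b].
Proof. by apply/seteqP; split => k; rewrite /cylinder /= => -[-> ->]. Qed.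

Lemma measurable_cylinder w : measurable (cylinder w).
Proof.
elim: w => [|b w IH]; first by rewrite cylinder_nil.
by rewrite cylinder_cons; apply: measurableI => //; exact: measurable_coordinate.
Qed.

(** This makes [prod_cylinders] closed under intersection: the longer word either extends the
    shorter one or disagrees with it in a common position. *)
Lemma cylinderI w w' : (size w <= size w')%N ->
  cylinder w `&` cylinder w' = cylinder w' \/ cylinder w `&` cylinder w' = set0.
Proof.
elim: w' => [|b w' IH]; first by rewrite leqn0 size_eq0 => /eqP ->; left; rewrite setIid.
rewrite leq_eqVlt => /predU1P[sw|].
  have [->|wb] := eqVneq w (b :: w'); first by left; rewrite setIid.
  right; apply/seteqP; split => k //; rewrite /cylinder /= -/(prefix_word k (size (b :: w'))) => -[].
  by rewrite sw => kw kb; move/eqP: wb; apply; rewrite -kw.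
rewrite ltnS => /IH; rewrite cylinder_cons setIA => -[] ->; first by left.
by right; rewrite set0I.
Qed.

Definition prod_cylinders : set (set (T * bitstream)) :=
  [set A `*` cylinder w | A in measurable & w in setT].

Lemma measurable_prod_cylinders : @measurable _ (T * bitstream)%type = <<s prod_cylinders >>.
Proof.
apply/seteqP; split; last first.
  apply: smallest_sub; first exact: sigma_algebra_measurable.
  by move=> _ [A mA [w _ <-]]; apply: measurableX => //; exact: measurable_cylinder.
have sG : sigma_algebra setT <<s prod_cylinders >> by exact: smallest_sigma_algebra.
apply: smallest_sub => //.
move=> _ [] [A mA <-]; rewrite setTI.
  apply: sub_sigma_algebra; exists A => //; exists [::] => //.
  by rewrite cylinder_nil setXT.
have : [set A : set bitstream | <<s prod_cylinders >> (snd @^-1` A)] A.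
  apply: mA; split.
    case: sG => s0 sC sU; split => [|B sB|F HF].
    - by rewrite /= preimage_set0.
    - by rewrite /= setTD -preimage_setC -setTD; exact: sC.
    - by rewrite /= preimage_bigcup; exact: sU.
  move=> _ [i [b ->]] /=.
  (* The event that bit [i] is [b] is a countable union of cylinders, over the words of length
     [i.+1] whose head, the last letter, is [b]. *)
  pose F (j : nat) : set (T * bitstream) := if unpickle j is Some (b' :: w) then
    if (b' == b) && (size w == i) then [set: T] `*` cylinder (b' :: w) else set0 else set0.
  have sF j : <<s prod_cylinders >> (F j).
    case: sG => s0 _ _; rewrite /F; case: (unpickle j) => [[|b' w]|].
    - exact: s0.
    - case: ifP => _; last exact: s0.
      by apply: sub_sigma_algebra; exists setT => //; exists (b' :: w).
    - exact: s0.
  suff -> : snd @^-1` [set k : bitstream | k i = b] = \bigcup_j F j.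
    by case: sG => _ _; exact.
  apply/seteqP; split => [[t k] /= kb|[t k] [j _]].
    exists (pickle (prefix_word k i.+1)) => //.
    by rewrite /F pickleK /= kb eqxx /= size_prefix_word eqxx; split => //;
       rewrite /cylinder /= size_prefix_word -kb.
  rewrite /F; case: unpickle => [[|b' w]|] //; case: ifP => // /andP[/eqP <- /eqP <-] [_].
  by rewrite /cylinder /= => -[-> _].
by [].
Qed.

Lemma bitstream_measure_unique (R : realType)
    (m1 m2 : {finite_measure set (T * bitstream)%type -> \bar R}) :
  (forall A w, measurable A -> m1 (A `*` cylinder w) = m2 (A `*` cylinder w)) ->
  forall S, measurable S -> m1 S = m2 S.
Proof.
move=> m12; apply: (measure_unique prod_cylinders (fun=> setT)).
- exact: measurable_prod_cylinders.
- move=> _ _ [A mA [w _ <-]] [A' mA' [w' _ <-]].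
  rewrite -setXI.
  have aux B v v' : measurable B -> (size v <= size v')%N ->
      prod_cylinders (B `*` (cylinder v `&` cylinder v')).
    move=> mB vv'; case: (cylinderI vv') => ->.
      by exists B => //; exists v'.
    by exists set0 => //; exists [::] => //; rewrite set0X setX0.
  have mAA' := measurableI _ _ mA mA'.
  have [ww'|/ltnW w'w] := leqP (size w) (size w'); first exact: aux.
  by rewrite [cylinder w `&` _]setIC; exact: aux.
- by move=> _; exists setT => //; exists [::] => //; rewrite cylinder_nil setXTT.
- by rewrite bigcup_const.
- by move=> _ [A mA [w _ <-]]; exact: m12.
- by move=> _; rewrite ltey_eq fin_num_measure.
Qed.

End bitstream_measurability.

Section real_encoding.
Variable R : realType.

Definition rat_seq n : R := ratr (odflt 0 (unpickle n)).

(** The Dedekind cut of [x] along an enumeration of the rationals. *)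
Definition enc (x : R) : bitstream := fun n => rat_seq n <= x.

(** [esups] at 0 is the supremum over all indices; [fine] makes the decoding total, as the supremum
    may be infinite for codes that are not cuts. *)
Definition dec (k : bitstream) : R :=
  fine (esups (fun n => if k n then (rat_seq n)%:E else -oo%E) 0).

Lemma encK : cancel enc dec.
Proof.
move=> x; rewrite /dec /esups /sdrop /=.
rewrite (_ : ereal_sup _ = x%:E)//; apply/eqP; rewrite eq_le; apply/andP; split.
  by apply: ge_ereal_sup => _ [n _ <-]; rewrite /enc; case: ifP => //; rewrite ?leNye.
apply/lee_addgt0Pr => e e0.
have /rat_in_itvoo[z] : x - e < x by rewrite ltrBlDr ltrDl.
rewrite in_itv /= => /andP[xez zx].
apply: (@le_trans _ _ ((ratr z)%:E + e%:E)%E); first by rewrite lee_fin -lerBlDr ltW.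
apply: leeD => //; apply: ereal_sup_ubound; exists (pickle z) => //.
by rewrite /enc /rat_seq pickleK /= ltW.
Qed.

Lemma measurable_enc : measurable_fun setT enc.
Proof. by apply/measurable_fun_bitstream => i; exact: measurable_fun_ler. Qed.

Lemma measurable_dec : measurable_fun setT dec.
Proof.
apply: (measurableT_comp (f := fine)); first exact: fine_measurable.
apply: measurable_fun_esups => n.
apply: measurable_fun_ifT => //.
exact: ((measurable_fun_bitstream id).2 (@measurable_id _ _ _) n).
Qed.

Definition enc2 (p : R * R) : bitstream :=
  fun n => if odd n then enc p.2 n./2 else enc p.1 n./2.

Definition dec2 (k : bitstream) : R * R :=
  (dec (fun n => k n.*2), dec (fun n => k n.*2.+1)).

Lemma enc2K : cancel enc2 dec2.
Proof.
move=> [x y]; rewrite /dec2 /enc2; congr pair.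
  by rewrite -[RHS]encK; congr dec; apply/funext => n; rewrite odd_double doubleK.
by rewrite -[RHS]encK; congr dec; apply/funext => n; rewrite /= odd_double uphalf_double.
Qed.

Lemma measurable_enc2 : measurable_fun setT enc2.
Proof.
apply/measurable_fun_bitstream => i; rewrite /enc2.
have me j := (measurable_fun_bitstream enc).2 measurable_enc j.
by case: (odd i); apply: (measurableT_comp (me i./2)).
Qed.

Lemma measurable_subseq_dec (f : nat -> nat) :
  measurable_fun setT (fun k : bitstream => dec (fun n => k (f n))).
Proof.
apply: (measurableT_comp measurable_dec).
apply/measurable_fun_bitstream => i.
exact: ((measurable_fun_bitstream id).2 (@measurable_id _ _ _) (f i)).
Qed.

Lemma measurable_dec2 : measurable_fun setT dec2.
Proof. by apply: measurable_fun_pair; exact: measurable_subseq_dec. Qed.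

(** One bit stream codes a real number for every word: a candidate for the masses of all cylinders
    at once. *)
Definition decode_family (k : bitstream) (w : seq bool) : R :=
  dec (fun n => k (pickle (w, n))).

Lemma decode_family_surj (c : seq bool -> R) : exists k, decode_family k = c.
Proof.
exists (fun j => if unpickle j is Some (w, n) then enc (c w) n else false).
apply/funext => w; rewrite /decode_family -[RHS]encK; congr dec.
by apply/funext => n; rewrite pickleK.
Qed.

Lemma measurable_decode_family w : measurable_fun setT (decode_family ^~ w).
Proof. exact: measurable_subseq_dec. Qed.

End real_encoding.

(** * Transfer of probabilities to a uniform variable *)

Section law.
Context d d' (T : measurableType d) (T' : measurableType d') (R : realType).
Variables (P : probability T R) (f : T -> T') (mf : measurable_fun setT f).

HB.instance Definition _ := isMeasurableFun.Build _ _ _ _ f mf.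

Definition law : probability T' R := distribution P f.

Lemma ge0_integral_law (g : T' -> \bar R) : measurable_fun setT g -> (forall y, 0 <= g y)%E ->
  (\int[law]_y g y = \int[P]_x g (f x))%E.
Proof. by move=> mg g0; rewrite ge0_integral_distribution. Qed.

End law.

Section unif01.
Context {R : realType}.

Let measurable_itv01 : measurable (`[0, 1[%classic : set R).
Proof. exact: measurable_itv. Qed.

Definition unif01 : set R -> \bar R := mrestr lebesgue_measure measurable_itv01.

Let unif01_0 : unif01 set0 = 0%E.
Proof. exact: (measure0 (mrestr lebesgue_measure measurable_itv01)). Qed.

Let unif01_ge0 A : (0 <= unif01 A)%E.
Proof. exact: (measure_ge0 (mrestr lebesgue_measure measurable_itv01)). Qed.

Let unif01_sigma_additive : semi_sigma_additive unif01.
Proof. exact: (@measure_semi_sigma_additive _ _ _ (mrestr lebesgue_measure measurable_itv01)). Qed.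

HB.instance Definition _ := isMeasure.Build _ _ _ unif01
  unif01_0 unif01_ge0 unif01_sigma_additive.

Let unif01_setT : unif01 setT = 1%E.
Proof. by rewrite /unif01 /mrestr setTI lebesgue_measure_itv /= lte01 sube0. Qed.

HB.instance Definition _ := Measure_isProbability.Build _ _ _ unif01 unif01_setT.

Lemma unif01_itv (A : set R) (a b : R) : a <= b ->
  A `&` `[0, 1[ = `[a, b[%classic -> unif01 A = (b - a)%:E.
Proof.
move=> ab; rewrite /unif01 /mrestr => ->; rewrite lebesgue_measure_itv /= lte_fin.
by move: ab; rewrite le_eqVlt => /predU1P[->|->//]; rewrite ltxx subrr.
Qed.

End unif01.

Section random_bits.
Context {R : realType}.
Implicit Types (c : seq bool -> R) (w : seq bool) (v : R).

(** Kolmogorov's consistency conditions for the masses of cylinders under a probability on the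
    Cantor space. *)
Definition consistent c :=
  [/\ c [::] = 1, forall w, 0 <= c w & forall w, c w = c (false :: w) + c (true :: w)].

Fixpoint left_end c w : R :=
  if w is b :: w' then left_end c w' + (if b then c (false :: w') else 0) else 0.

Fixpoint bit_word c v n : seq bool :=
  if n is n'.+1 then
    let w := bit_word c v n' in (left_end c w + c (false :: w) <= v) :: w
  else [::].

(* The words of length [n] cut [0, 1[ into consecutive intervals of lengths [c w];
   the bits of [v] are those of the word whose interval contains [v]. *)
Definition random_bits c v : bitstream := fun n => head false (bit_word c v n.+1).

Lemma prefix_random_bits c v n : prefix_word (random_bits c v) n = bit_word c v n.
Proof. by elim: n => //= n ->. Qed.

(** By induction on the word: the interval of [w] is cut at [left_end c w + c (false :: w)], the
    threshold that decides the next bit. *)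
Lemma random_bits_cylinder c w : consistent c ->
  (random_bits c @^-1` cylinder w) `&` `[0, 1[ = `[left_end c w, left_end c w + c w[%classic.
Proof.
move=> [c1 c0 cD]; elim: w => [|b w IH].
  by rewrite cylinder_nil preimage_setT setTI /= c1 add0r.
rewrite cylinder_cons preimage_setI setIAC IH.
have Hc0 := c0 (false :: w); have Hc1 := c0 (true :: w); have HD := cD w.
have bit v : `[left_end c w, left_end c w + c w[%classic v ->
    random_bits c v (size w) = (left_end c w + c (false :: w) <= v).
  by rewrite -IH /random_bits /= -prefix_random_bits => -[->].
apply/seteqP; split => v /=; rewrite !in_itv /=.
  move=> [lwv /esym bE]; rewrite bit// in bE; move: lwv => /andP[lv vl].
  by case: b bE => /esym; [move=> H|move/negbT; rewrite -ltNge => H]; apply/andP; split; lra.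
move=> lbv; have lwv : left_end c w <= v < left_end c w + c w.
  by case: b lbv => /andP[? ?]; apply/andP; split; lra.
split => //; rewrite bit//.
by case: b lbv => /andP[? ?]; [apply/idP|apply/negbTE; rewrite -ltNge]; lra.
Qed.

Lemma unif01_cylinder c w : consistent c ->
  unif01 (random_bits c @^-1` cylinder w) = (c w)%:E.
Proof.
move=> cc; rewrite (unif01_itv (a := left_end c w) (b := left_end c w + c w)).
- by rewrite addrC addKr.
- by rewrite lerDl; case: cc.
- exact: random_bits_cylinder.
Qed.

End random_bits.

Section measurable_random_bits.
Context d (T : measurableType d) (R : realType) (c : T -> seq bool -> R).
Hypothesis mc : forall w, measurable_fun setT (c ^~ w).

Lemma measurable_left_end w : measurable_fun setT (fun t => left_end (c t) w).
Proof.
elim: w => [|b w IH] /=; first exact: measurable_cst.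
by apply: measurable_funD => //; case: b.
Qed.

Lemma measurable_random_bits :
  measurable_fun setT (fun p : T * R => random_bits (c p.1) p.2).
Proof.
have mw n w : measurable [set p : T * R | bit_word (c p.1) p.2 n = w].
  elim: n w => [|n IH] w.
    by case: w => [|b w]; [rewrite (_ : mkset _ = setT)|rewrite (_ : mkset _ = set0)] => //;
      apply/seteqP; split.
  case: w => [|b w]; first by rewrite (_ : mkset _ = set0) //; apply/seteqP; split.
  rewrite (_ : mkset _ = [set p : T * R | bit_word (c p.1) p.2 n = w] `&`
    ((fun p => left_end (c p.1) w + c p.1 (false :: w) <= p.2) @^-1` [set b])); last first.
    apply/seteqP; split => p /=; first by move=> [<- ->].
    by move=> [-> ->].
  apply: measurableI => //; rewrite -[X in measurable X]setTI.
  apply: measurable_fun_ler => //.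
  apply: measurable_funD.
    exact: (measurableT_comp (measurable_left_end w) measurable_fst).
  exact: (measurableT_comp (mc _) measurable_fst).
apply/measurable_fun_bitstream => i; apply: (measurable_fun_bool true); rewrite setTI.
pose F (j : nat) : set (T * R) := if unpickle j is Some w then
  [set p : T * R | bit_word (c p.1) p.2 i.+1 = true :: w] else set0.
rewrite (_ : _ @^-1` _ = \bigcup_j F j).
  apply: bigcupT_measurable => j; rewrite /F.
  by case: (unpickle j) => [w|]; [exact: mw|exact: measurable0].
apply/seteqP; split => [p pb|p [j _]].
  exists (pickle (bit_word (c p.1) p.2 i)) => //; rewrite /F pickleK /=.
  by move: pb; rewrite /random_bits /= => ->.
rewrite /F; case: (unpickle j) => [w|//].
by rewrite /random_bits /= => -[].
Qed.

End measurable_random_bits.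

Section transfer.
Context d (T : measurableType d) d' (Y : measurableType d') (R : realType).
Variables (encY : Y -> bitstream) (decY : bitstream -> Y).
Hypotheses (encYK : cancel encY decY)
  (mencY : measurable_fun setT encY) (mdecY : measurable_fun setT decY).
Local Open Scope ereal_scope.

Lemma measurable_transfer_map (c : T -> seq bool -> R) :
  (forall w, measurable_fun setT (c ^~ w)) ->
  measurable_fun setT (fun p : T * R => decY (random_bits (c p.1) p.2)).
Proof. by move=> mc; apply: (measurableT_comp mdecY); exact: measurable_random_bits. Qed.

(** Both sides are compared after encoding [Y] into bit streams, where rectangles over cylinders
    determine a finite measure. There the product measure is computed by sections, whose masses off
    [N] are given by [unif01_cylinder]; decoding leads back to [Y]. *)
Lemma transfer (tau : probability T R) (Gam : probability (T * Y)%type R)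
    (c : T -> seq bool -> R) N :
  (forall w, measurable_fun setT (c ^~ w)) ->
  measurable N -> tau N = 0 -> (forall t, ~ N t -> consistent (c t)) ->
  (forall t w, (0 <= c t w)%R) ->
  (forall A w, measurable A ->
    Gam (A `*` (encY @^-1` cylinder w)) = \int[tau]_(t in A) (c t w)%:E) ->
  forall S, measurable S ->
  Gam S = (tau \x unif01) ((fun p => (p.1, decY (random_bits (c p.1) p.2))) @^-1` S).
Proof.
move=> mc mN tN cc c0 GamE S mS.
have me : measurable_fun setT (fun p : T * Y => (p.1, encY p.2)).
  by apply: measurable_fun_pair => //; exact: measurableT_comp.
have mb : measurable_fun setT (fun p : T * R => (p.1, random_bits (c p.1) p.2)).
  by apply: measurable_fun_pair => //; exact: measurable_random_bits.
have md : measurable_fun setT (fun p : T * bitstream => (p.1, decY p.2)).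
  by apply: measurable_fun_pair => //; exact: measurableT_comp.
have agree S' : measurable S' -> law Gam me S' = law (tau \x unif01) mb S'.
  apply: bitstream_measure_unique => {S mS S'} A w mA.
  transitivity (\int[tau]_(t in A) (c t w)%:E); first exact: GamE.
  have mS' : measurable ((fun p : T * R => (p.1, random_bits (c p.1) p.2)) @^-1` (A `*` cylinder w)).
    by rewrite -[X in measurable X]setTI; apply: mb => //; apply: measurableX => //; exact: measurable_cylinder.
  change (law (tau \x unif01) mb (A `*` cylinder w)) with ((tau \x unif01)
    ((fun p : T * R => (p.1, random_bits (c p.1) p.2)) @^-1` (A `*` cylinder w))).
  rewrite /product_measure1 integral_mkcond.
  apply: ge0_ae_eq_integral => //.
  - apply/(measurable_restrictT _ mA).1; apply: measurable_funTS.
    by apply/measurable_EFinP.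
  - exact: measurable_fun_xsection.
  - by move=> t _; rewrite patchE; case: ifP => //; rewrite lee_fin.
  - exists N; split => // t /= /not_implyP[_ neq]; apply: contrapT => Nt; apply: neq.
    rewrite patchE; case: ifPn => [/set_mem At|/negP nA].
      rewrite -(unif01_cylinder w (cc t Nt)); congr (unif01 _).
      by apply/seteqP; split => v; rewrite /xsection /= inE //= => -[].
    rewrite (_ : xsection _ _ = set0) ?measure0//.
    by apply/seteqP; split => v //; rewrite /xsection /= inE => -[/= /mem_set].
transitivity (law Gam me ((fun p : T * bitstream => (p.1, decY p.2)) @^-1` S)).
  congr (Gam _); by apply/seteqP; split => -[t y] /=; rewrite encYK.
by apply: agree; rewrite -[X in measurable X]setTI; exact: md.
Qed.
End transfer.

(** * Disintegration *)

Section slice.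
Context d (T : measurableType d) d' (Y : measurableType d') (R : realType).
Variables (Gam : probability (T * Y)%type R) (E : set Y) (mE : measurable E).

(** The unnamed argument carries the measurability of [E], from which the measure instance below is
    built. *)
Definition slice_measure (_ : measurable E) (A : set T) : \bar R := Gam (A `*` E).

Let slice0 : slice_measure mE set0 = 0%E.
Proof. by rewrite /slice_measure set0X measure0. Qed.

Let slice_ge0 A : (0 <= slice_measure mE A)%E.
Proof. exact: measure_ge0. Qed.

Let slice_sigma_additive : semi_sigma_additive (slice_measure mE).
Proof.
move=> F mF tF mUF; rewrite /slice_measure.
have -> : (\bigcup_n F n) `*` E = \bigcup_n (F n `*` E).
  apply/seteqP; split => [[x y] [[n _ Fx] Ey]|[x y] [n _ [Fx Ey]]]; first by exists n.
  by split => //; exists n.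
apply: measure_semi_sigma_additive.
- by move=> n; exact: measurableX.
- apply/trivIsetP => i j _ _ ij; move/trivIsetP : tF => /(_ i j I I ij) Fij.
  by rewrite -setXI Fij set0X.
- by apply: bigcupT_measurable => n; exact: measurableX.
Qed.

HB.instance Definition _ := isMeasure.Build _ _ _ (slice_measure mE)
  slice0 slice_ge0 slice_sigma_additive.

Let slice_fin : fin_num_fun (slice_measure mE).
Proof. by move=> A mA; apply: fin_num_measure; exact: measurableX. Qed.

HB.instance Definition _ := Measure_isFinite.Build _ _ _ (slice_measure mE) slice_fin.

End slice.

Section disintegration.
Context d (T : measurableType d) d' (Y : measurableType d') (R : realType).
Variables (Gam : probability (T * Y)%type R) (encY : Y -> bitstream).
Hypothesis mencY : measurable_fun setT encY.
Local Open Scope ereal_scope.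
Let tau := law Gam measurable_fst.

Let mcyl w : measurable (encY @^-1` cylinder w).
Proof. by rewrite -[X in measurable X]setTI; apply: mencY => //; exact: measurable_cylinder. Qed.

(** [c t w] is the Radon-Nikodym derivative at [t] of the slice of [Gam] over the cylinder [w]. Each
    consistency equation holds off a null set, and there are countably many words, so a single null
    set [N] serves for all. *)
Lemma conditional_code : exists (c : T -> seq bool -> R) N,
  [/\ forall w, measurable_fun setT (c ^~ w), forall t w, (0 <= c t w)%R,
      measurable N /\ tau N = 0, forall t, ~ N t -> consistent (c t) &
      forall A w, measurable A ->
        Gam (A `*` (encY @^-1` cylinder w)) = \int[tau]_(t in A) (c t w)%:E].
Proof.
have dom w : slice_measure Gam (mcyl w) `<< tau.
  apply/null_content_dominatesP => A mA tA.
  apply/eqP; rewrite eq_le measure_ge0 andbT -tA.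
  apply: le_measure; rewrite ?inE.
  - exact: measurableX.
  - by rewrite -[X in measurable X]setTI; exact: measurable_fst.
  - by move=> p [].
have /choice[f] w := radon_nikodym_sigma_finite (dom w).
move=> /all_and4[f0 ffin fint slE].
have fE w A : measurable A -> Gam (A `*` (encY @^-1` cylinder w)) = \int[tau]_(t in A) f w t.
  exact: slE.
have fineE w t : (fine (f w t))%:E = f w t by rewrite fineK.
have mf w : measurable_fun setT (f w) by case/integrableP: (fint w).
(* A cylinder is the disjoint union of those of its two extensions, so both sides have equal
   integrals over every measurable set. *)
have step w : {ae tau, forall t, setT t -> f w t = f (false :: w) t + f (true :: w) t}.
  apply: integral_ae_eq => //; first exact: emeasurable_funD.
  move=> A _ mA; rewrite ge0_integralD//; [|exact: measurable_funTS..].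
  rewrite -!fE// -measureU//; [|exact: measurableX..|].
    congr (Gam _); rewrite !cylinder_cons; apply/seteqP; split => -[t y] /=.
      by move=> [At wy]; case: (encY y (size w)) (erefl (encY y (size w))); [right|left].
    by move=> [[At [wy _]]|[At [wy _]]].
  by rewrite -setXI !cylinder_cons; apply/seteqP; split => // -[t y] [_ [[_ /= ->] [_ ]]].
have init : {ae tau, forall t, setT t -> f [::] t = cst 1 t}.
  apply: integral_ae_eq => // A _ mA.
  rewrite -fE// cylinder_nil preimage_setT integral_cst// mul1e.
  by rewrite setXT.
have /choice[M HM] w : exists M, [/\ measurable M, tau M = 0 & forall t, ~ M t ->
    f w t = f (false :: w) t + f (true :: w) t].
  have [M [mM M0 sM]] := step w; exists M; split => // t Mt.
  by apply: contrapT => neq; apply: Mt; apply: sM => /= /(_ I).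
have [M0 [mM0 tM0 sM0]] := init.
pose F (j : nat) : set T := if unpickle j is Some w then M w else set0.
pose N := M0 `|` \bigcup_j F j.
exists (fun t w => fine (f w t)), N; split.
- by move=> w; exact: measurableT_comp (fine_measurable measurableT) (mf w).
- by move=> t w; exact: fine_ge0.
- have mU : measurable (\bigcup_j F j).
    apply: bigcupT_measurable => j; rewrite /F.
    by case: (unpickle j) => [w|]; [case: (HM w)|exact: measurable0].
  split; first exact: measurableU.
  apply: (@measure_negligible _ _ _ tau); first exact: measurableU.
  apply: negligibleU; first by exists M0; split.
  apply: negligible_bigcup => j; rewrite /F; case: (unpickle j) => [w|]; last exact: negligible_set0.
  by case: (HM w) => mMw tMw _; exists (M w); split.
- move=> t Nt; split => [|w|w].
  + have ft : f [::] t = 1; last by rewrite ft.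
    by apply: contrapT => neq; apply: Nt; left; apply: sM0 => /= /(_ I).
  + exact: fine_ge0.
  + have [_ _ ->] := HM w; first by rewrite fineD.
    by move=> Mt; apply: Nt; right; exists (pickle w) => //; rewrite /F pickleK.
- move=> A w mA; rewrite (eq_integral (f w)); last by move=> t _; exact: fineE.
  exact: fE.
Qed.

(** The functional form of disintegration: [conditional_code] supplies the conditional masses of
    cylinders, and [transfer] realizes them by a uniform variable. *)
Lemma noise_outsourcing (decY : bitstream -> Y) :
  cancel encY decY -> measurable_fun setT decY ->
  exists2 G : T * R -> Y, measurable_fun setT G &
  forall S, measurable S -> Gam S = (tau \x unif01) ((fun p => (p.1, G p)) @^-1` S).
Proof.
move=> encYK mdecY; have [c [N [mc c0 [mN tN] cc GamE]]] := conditional_code.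
exists (fun p => decY (random_bits (c p.1) p.2)); first exact: (measurable_transfer_map mdecY mc).
exact: (transfer encYK mencY mdecY mc mN tN cc c0 GamE).
Qed.

End disintegration.

(** * The fused Gromov-Wasserstein cost *)

Section eq_integral_set_function.
Context d (T : measurableType d) (R : realType).
Import HBNNSimple.

(** [integral] accepts bare set functions such as [surface_measure]. It evaluates them only on level
    sets of simple functions, which are measurable. *)
Lemma eq_integral_set_function (m1 m2 : set T -> \bar R) (D : set T) (f : T -> \bar R) :
  (forall A, measurable A -> m1 A = m2 A) -> integral m1 D f = integral m2 D f.
Proof.
move=> m12.
have E (h : {nnsfun T >-> R}) : sintegral m1 h = sintegral m2 h.
  apply: eq_fsbigr => x _; congr (_ * _)%E; apply: m12.
  exact: measurable_sfunP.
have S g : [set sintegral m1 h | h in [set h : {nnsfun T >-> R} | forall x, ((h x)%:E <= g x)%E]] =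
           [set sintegral m2 h | h in [set h : {nnsfun T >-> R} | forall x, ((h x)%:E <= g x)%E]].
  by apply/seteqP; split => _ [h hg <-]; exists h.
by rewrite /integral !S.
Qed.

End eq_integral_set_function.

Section fgw_cost.
Context (R : realType) (beta : R) (d1 : R -> R -> R).
Hypothesis md1 : measurable_fun [set: R * R] (fun p : R * R => d1 p.1 p.2).
Hypothesis beta01 : 0 <= beta <= 1.
Hypothesis d10 : forall x y, 0 <= d1 x y.
Local Open Scope ereal_scope.

(** The objective of [D_fgw] for two random variables on an arbitrary space, so that three variables
    can be compared on one space. *)
Definition fgw_cost d (Z : measurableType d) (P : set Z -> \bar R) (f g : Z -> R) : \bar R :=
  (1 - beta)%:E * \int[P]_z (d1 (f z) (g z))%:E +
  beta%:E * \int[P]_z \int[P]_w ((d1 (f z) (f w) - d1 (g z) (g w)) ^+ 2)%:E.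

Lemma fgw_cost_ge0 d (Z : measurableType d) (P : {measure set Z -> \bar R}) f g :
  0 <= fgw_cost P f g.
Proof.
move/andP: beta01 => [b0 b1]; apply: adde_ge0; apply: mule_ge0.
- by rewrite lee_fin subr_ge0.
- by apply: integral_ge0 => z _; rewrite lee_fin.
- by rewrite lee_fin.
- by do 2!(apply: integral_ge0 => ? _); rewrite lee_fin sqr_ge0.
Qed.

Lemma eq_fgw_cost d (Z : measurableType d) (P Q : set Z -> \bar R) f g :
  (forall A, measurable A -> P A = Q A) -> fgw_cost P f g = fgw_cost Q f g.
Proof.
move=> PQ; rewrite /fgw_cost; congr (_ * _ + _ * _); first exact: eq_integral_set_function.
rewrite (eq_integral_set_function _ _ PQ); congr integral.
by apply/funext => z; exact: eq_integral_set_function.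
Qed.

Section measurability.
Context d (Z : measurableType d).
Variables (f g : Z -> R).
Hypotheses (mf : measurable_fun setT f) (mg : measurable_fun setT g).

Lemma measurable_cost_linear : measurable_fun setT (fun z => (d1 (f z) (g z))%:E).
Proof.
by apply/measurable_EFinP; exact: (measurableT_comp md1 (measurable_fun_pair mf mg)).
Qed.

Lemma measurable_cost_quadratic : measurable_fun setT
  (fun p : Z * Z => ((d1 (f p.1) (f p.2) - d1 (g p.1) (g p.2)) ^+ 2)%:E).
Proof.
have md (h : Z -> R) : measurable_fun setT h ->
    measurable_fun setT (fun p : Z * Z => d1 (h p.1) (h p.2)).
  move=> mh; exact: (measurableT_comp md1 (measurable_fun_pair
    (measurableT_comp mh measurable_fst) (measurableT_comp mh measurable_snd))).
by apply/measurable_EFinP; apply: measurable_funX; apply: measurable_funB; exact: md.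
Qed.

Lemma measurable_cost_integral (P : {sigma_finite_measure set Z -> \bar R}) : measurable_fun setT
  (fun z => \int[P]_w ((d1 (f z) (f w) - d1 (g z) (g w)) ^+ 2)%:E).
Proof.
have s0 (p : Z * Z) : 0 <= ((d1 (f p.1) (f p.2) - d1 (g p.1) (g p.2)) ^+ 2)%:E.
  by rewrite lee_fin sqr_ge0.
exact: (measurable_fun_fubini_tonelli_F (m2 := P) _ measurable_cost_quadratic s0).
Qed.

Lemma measurable_cost_section z : measurable_fun setT
  (fun w => ((d1 (f z) (f w) - d1 (g z) (g w)) ^+ 2)%:E).
Proof. exact: (measurableT_comp measurable_cost_quadratic (pair1_measurable z)). Qed.

End measurability.

Lemma fgw_cost_law d (Z : measurableType d) d' (Z' : measurableType d') (P : probability Z R)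
    (phi : Z -> Z') (mphi : measurable_fun setT phi) f g :
  measurable_fun setT f -> measurable_fun setT g ->
  fgw_cost (law P mphi) f g = fgw_cost P (f \o phi) (g \o phi).
Proof.
move=> mf mg; rewrite /fgw_cost; congr (_ * _ + _ * _).
  rewrite (ge0_integral_law _ mphi (measurable_cost_linear mf mg))// => z.
  by rewrite lee_fin.
rewrite (ge0_integral_law _ mphi (measurable_cost_integral mf mg _)); last first.
  by move=> z; apply: integral_ge0 => w _; rewrite lee_fin sqr_ge0.
apply: eq_integral => z _.
rewrite (ge0_integral_law _ mphi (measurable_cost_section mf mg _))// => w.
by rewrite lee_fin sqr_ge0.
Qed.

Lemma fgw_costC d (Z : measurableType d) (P : set Z -> \bar R) f g :
  (forall x y, d1 x y = d1 y x) -> fgw_cost P f g = fgw_cost P g f.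
Proof.
move=> d1C; rewrite /fgw_cost; congr (_ * _ + _ * _).
  by congr integral; apply/funext => z; rewrite d1C.
congr integral; apply/funext => z; congr integral; apply/funext => w.
by rewrite -sqrrN opprB.
Qed.

Lemma fgw_cost_triangle d (Z : measurableType d) (P : probability Z R) f g h (C : R) :
  measurable_fun setT f -> measurable_fun setT g -> measurable_fun setT h ->
  (2 <= C)%R -> (forall x y z, d1 x z <= C * (d1 x y + d1 y z))%R ->
  fgw_cost P f h <= C%:E * (fgw_cost P f g + fgw_cost P g h).
Proof.
move=> mf mg mh C2 tri; move/andP: beta01 => [b0 b1].
have C0 : (0 <= C)%R by rewrite (le_trans _ C2).
pose I f g := \int[P]_z (d1 (f z) (g z))%:E.
pose J f g := \int[P]_z \int[P]_w ((d1 (f z) (f w) - d1 (g z) (g w)) ^+ 2)%:E.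
have I0 u v : 0 <= I u v by apply: integral_ge0 => z _; rewrite lee_fin.
have J0 u v : 0 <= J u v by do 2!(apply: integral_ge0 => ? _); rewrite lee_fin sqr_ge0.
have d0 u v z : 0 <= (d1 (u z) (v z))%:E by rewrite lee_fin.
have s0 (u v : Z -> R) z w : 0 <= ((d1 (u z) (u w) - d1 (v z) (v w)) ^+ 2)%:E by rewrite lee_fin sqr_ge0.
have IH : I f h <= C%:E * (I f g + I g h).
  rewrite /I -ge0_integralD//; [|exact: measurable_cost_linear..].
  rewrite -ge0_integralZl_EFin//; last 2 first.
  - by move=> z _; exact: adde_ge0.
  - by apply: emeasurable_funD; exact: measurable_cost_linear.
  apply: ge0_le_integral => //.
  - exact: measurable_cost_linear.
  - apply: measurable_funeM; apply: emeasurable_funD; exact: measurable_cost_linear.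
  - by move=> z _; rewrite -EFinD -EFinM lee_fin.
have JH : J f h <= C%:E * (J f g + J g h).
  have F0 u v z : 0 <= \int[P]_w ((d1 (u z) (u w) - d1 (v z) (v w)) ^+ 2)%:E.
    by apply: integral_ge0.
  rewrite /J -ge0_integralD//; [|exact: measurable_cost_integral..].
  rewrite -ge0_integralZl_EFin//; last 2 first.
  - by move=> z _; exact: adde_ge0.
  - by apply: emeasurable_funD; exact: measurable_cost_integral.
  apply: ge0_le_integral => //.
  - exact: measurable_cost_integral.
  - apply: measurable_funeM; apply: emeasurable_funD; exact: measurable_cost_integral.
  move=> z _; rewrite -ge0_integralD//; [|exact: measurable_cost_section..].
  rewrite -ge0_integralZl_EFin//; last 2 first.
  - by move=> w _; exact: adde_ge0.
  - by apply: emeasurable_funD; exact: measurable_cost_section.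
  apply: ge0_le_integral => //.
  - exact: measurable_cost_section.
  - apply: measurable_funeM; apply: emeasurable_funD; exact: measurable_cost_section.
  - move=> w _; rewrite -EFinD -EFinM lee_fin.
    set a := d1 _ _; set b := d1 (h z) (h w); set c := d1 (g z) (g w).
    apply: (@le_trans _ _ (2 * ((a - c) ^+ 2 + (c - b) ^+ 2))%R).
      (* The difference of the two sides is [(a + b - 2 * c) ^+ 2]. *)
      by have := sqr_ge0 (a + b - 2 * c)%R; nra.
    by apply: ler_wpM2r => //; rewrite addr_ge0 ?sqr_ge0.
rewrite /fgw_cost -/(I f h) -/(I f g) -/(I g h) -/(J f h) -/(J f g) -/(J g h).
have b0' : 0 <= beta%:E by rewrite lee_fin.
have b1' : 0 <= (1 - beta)%:E by rewrite lee_fin subr_ge0.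
have C0' : 0 <= C%:E by rewrite lee_fin.
rewrite addeACA -!ge0_muleDr//.
rewrite [leRHS]ge0_muleDr.
- by rewrite !(muleCA C%:E); apply: leeD; exact: lee_wpmul2l.
- by apply: mule_ge0 => //; exact: adde_ge0.
- by apply: mule_ge0 => //; exact: adde_ge0.
Qed.

End fgw_cost.

(** * Gluing of couplings *)

Section gluing.
Context (R : realType).

Lemma gluing (rho eta zeta : set R -> \bar R) (gam1 gam2 : probability (R * R)%type R) :
  is_coupling rho eta gam1 -> is_coupling eta zeta gam2 ->
  exists (G : (R * R) * R -> R),
  [/\ measurable_fun setT G,
    forall S, measurable S -> gam1 S = (gam1 \x unif01)%E ((fun z => (z.1.1, z.1.2)) @^-1` S) &
    forall S, measurable S -> gam2 S = (gam1 \x unif01)%E ((fun z => (z.1.2, G z)) @^-1` S)].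
Proof.
move=> cp1 cp2.
have [G mG GE] := noise_outsourcing gam2 (@measurable_enc R) (@encK R) (@measurable_dec R).
have m12 : measurable_fun setT (fun z : (R * R) * R => (z.1.2, z.2)).
  by apply: measurable_fun_pair => //; exact: (measurableT_comp measurable_snd measurable_fst).
exists (fun z => G (z.1.2, z.2)); split.
- exact: (measurableT_comp mG m12).
- move=> S mS; rewrite (_ : _ @^-1` S = S `*` setT); last first.
    by apply/seteqP; split => -[[s t] v] /=; tauto.
  rewrite product_measure1E//.
  by rewrite -[LHS]mule1; congr (_ * _)%E; apply/esym; exact: probability_setT.
- move=> S mS; rewrite GE//.
  pose tau := law gam2 (@measurable_fst _ _ R R).
  set X := (fun p => (p.1, G p)) @^-1` S.
  have mX : measurable X.
    rewrite /X -[X in measurable X]setTI.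
    by apply: measurable_fun_pair.
  (* The pair [(t, v)] has as its law the product of the common marginal and [unif01]: on a
     rectangle both give [eta A] times the mass of [B]. *)
  rewrite (product_measure_unique (m' := law (gam1 \x unif01)%E m12))//.
  move=> A B mA mB.
  transitivity ((gam1 \x unif01)%E ((setT `*` A) `*` B)).
    by congr ((gam1 \x unif01)%E _); apply/seteqP; split => -[[s t] v] /=; tauto.
  rewrite product_measure1E//; last exact: measurableX.
  congr (_ * _)%E; transitivity (eta A); first by case: (cp1 A mA).
  by have [<- _] := cp2 A mA; rewrite setXT.
Qed.

End gluing.

(** Infima need not be attained: near-minimizers up to [e / (2 * K)] in each set leave a total error
    [e] after multiplication by [K]. An infinite infimum makes the bound trivial. *)
Lemma lee_mul_ereal_infD (R : realType) (x : \bar R) (K : R) (A B : set (\bar R)) :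
  (0 < K)%R -> (forall a, A a -> 0 <= a)%E -> (forall b, B b -> 0 <= b)%E ->
  (forall a b, A a -> B b -> x <= K%:E * (a + b))%E ->
  (x <= K%:E * (ereal_inf A + ereal_inf B))%E.
Proof.
move=> K0 A0 B0 xAB.
have iA0 : (0 <= ereal_inf A)%E by exact: le_ereal_inf_tmp.
have iB0 : (0 <= ereal_inf B)%E by exact: le_ereal_inf_tmp.
have [iAy|iAfin] := eqVneq (ereal_inf A) +oo%E.
  by rewrite iAy addye ?gt0_muley ?leey// gt_eqF// (lt_le_trans _ iB0).
have [iBy|iBfin] := eqVneq (ereal_inf B) +oo%E.
  by rewrite iBy addey ?gt0_muley ?leey// gt_eqF// (lt_le_trans _ iA0).
have fA : ereal_inf A \is a fin_num by rewrite ge0_fin_numE// ltey.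
have fB : ereal_inf B \is a fin_num by rewrite ge0_fin_numE// ltey.
apply/lee_addgt0Pr => e e0.
have d0 : 0 < e / (2 * K) by rewrite divr_gt0// mulr_gt0.
have [a Aa alt] := lb_ereal_inf_adherent d0 fA.
have [b Bb blt] := lb_ereal_inf_adherent d0 fB.
apply: (le_trans (xAB a b Aa Bb)).
move: alt blt; rewrite -(fineK fA) -(fineK fB).
move: (A0 a Aa) (B0 b Bb); case: a {Aa} => // a _; case: b {Bb} => // b _.
rewrite -!EFinD -EFinM !lte_fin lee_fin => alt blt.
have -> : e = K * (2 * (e / (2 * K))) by field; rewrite gt_eqF.
by rewrite -mulrDr ler_pM2l//; lra.
Qed.

Section D_fgw.
Context (R : realType) (beta : R) (d1 : R -> R -> R).
Hypothesis md1 : measurable_fun [set: R * R] (fun p : R * R => d1 p.1 p.2).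
Hypothesis beta01 : 0 <= beta <= 1.
Hypothesis d10 : forall x y, 0 <= d1 x y.
Hypothesis d1C : forall x y, d1 x y = d1 y x.
Local Open Scope ereal_scope.
Implicit Types rho eta zeta : set R -> \bar R.

Lemma D_fgwE rho eta : D_fgw rho eta beta d1 =
  ereal_inf [set fgw_cost beta d1 gam fst snd | gam in [set gam | is_coupling rho eta gam]].
Proof.
congr ereal_inf; apply/seteqP; split => [c [gam [cp ->]]|c [gam cp <-]].
  by exists gam.
by exists gam.
Qed.

Lemma D_fgw_ge0 rho eta : 0 <= D_fgw rho eta beta d1.
Proof. by rewrite D_fgwE; apply: le_ereal_inf_tmp => _ [gam _ <-]; exact: fgw_cost_ge0. Qed.

(** The joint law of [f] and [g] is a coupling, so competitors may live on any probability space. *)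
Lemma D_fgw_le rho eta d (Z : measurableType d) (P : probability Z R) f g :
  measurable_fun setT f -> measurable_fun setT g ->
  (forall A, measurable A -> P (f @^-1` A) = rho A /\ P (g @^-1` A) = eta A) ->
  D_fgw rho eta beta d1 <= fgw_cost beta d1 P f g.
Proof.
move=> mf mg cp; have mfg := measurable_fun_pair mf mg.
rewrite D_fgwE; apply: ereal_inf_lbound; exists (law P mfg); last exact: fgw_cost_law.
move=> A mA; have [<- <-] := cp A mA.
by split; congr (P _); apply/seteqP; split => z /=; tauto.
Qed.

Lemma D_fgwC rho eta : D_fgw rho eta beta d1 = D_fgw eta rho beta d1.
Proof.
suff le u v : D_fgw u v beta d1 <= D_fgw v u beta d1 by apply/eqP; rewrite eq_le !le.
rewrite [leRHS]D_fgwE; apply: le_ereal_inf_tmp => _ [gam cp <-].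
rewrite fgw_costC//; apply: D_fgw_le => // A mA.
by have [<- <-] := cp A mA; rewrite setXT setTX.
Qed.

Lemma D_fgw_triangle rho eta zeta (C : R) :
  (2 <= C)%R -> (forall x y z, d1 x z <= C * (d1 x y + d1 y z))%R ->
  D_fgw rho zeta beta d1 <= C%:E * (D_fgw rho eta beta d1 + D_fgw eta zeta beta d1).
Proof.
move=> C2 tri; rewrite [in leRHS]D_fgwE [X in _ * (_ + X)]D_fgwE.
apply: lee_mul_ereal_infD.
- exact: lt_le_trans C2.
- by move=> _ [gam _ <-]; exact: fgw_cost_ge0.
- by move=> _ [gam _ <-]; exact: fgw_cost_ge0.
move=> _ _ [gam1 cp1 <-] [gam2 cp2 <-].
have [G [mG E1 E2]] := gluing cp1 cp2.
(* One space carries three variables: [gam1] is the joint law of the first two, [gam2] that of the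
   second and [G]. *)
pose P : probability ((R * R) * R)%type R := (gam1 \x unif01)%E.
have mf : measurable_fun setT (fun z : (R * R) * R => z.1.1) by exact: measurableT_comp.
have mg : measurable_fun setT (fun z : (R * R) * R => z.1.2) by exact: measurableT_comp.
have -> : fgw_cost beta d1 gam1 fst snd = fgw_cost beta d1 P (fun z => z.1.1) (fun z => z.1.2).
  rewrite -(fgw_cost_law beta md1 d10 P (measurable_fun_pair mf mg) measurable_fst measurable_snd).
  exact: eq_fgw_cost.
have -> : fgw_cost beta d1 gam2 fst snd = fgw_cost beta d1 P (fun z => z.1.2) G.
  rewrite -(fgw_cost_law beta md1 d10 P (measurable_fun_pair mg mG) measurable_fst measurable_snd).
  exact: eq_fgw_cost.
apply: le_trans (fgw_cost_triangle md1 beta01 d10 P mf mg mG C2 tri).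
apply: D_fgw_le => // A mA; split.
  have [<- _] := cp1 A mA; rewrite E1; last exact: measurableX.
  by congr (P _); apply/seteqP; split => z /=; tauto.
have [_ <-] := cp2 A mA; rewrite E2; last exact: measurableX.
by congr (P _); apply/seteqP; split => z /=; tauto.
Qed.

End D_fgw.

(** * Measurability of the discrepancy in the direction *)

Section universal_parametrization.
Context (R : realType).

(** A one-point first factor reduces this to [bitstream_measure_unique]. *)
Lemma bitstream_probability_unique (P Q : probability bitstream R) :
  (forall w, P (cylinder w) = Q (cylinder w)) ->
  forall S, measurable S -> P S = Q S.
Proof.
move=> PQ S mS.
have mp : measurable_fun setT (fun k : bitstream => (tt, k)) by exact: measurable_fun_pair.
have E (M : probability bitstream R) (S' : set bitstream) : law M mp (setT `*` S') = M S'.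
  by congr (M _); apply/seteqP; split => k /=; tauto.
have agree S' : measurable S' -> law P mp S' = law Q mp S'.
  apply: bitstream_measure_unique => A w _; have [At|At] := pselect (A tt).
    have -> : A = setT by apply/seteqP; split => -[].
    exact: etrans (E P _) (etrans (PQ w) (esym (E Q _))).
  have -> : A = set0 by apply/seteqP; split => -[].
  by rewrite set0X !measure0.
apply: etrans (esym (E P S)) (etrans (agree _ _) (E Q S)).
exact: measurableX.
Qed.

Lemma encoded_probability_unique d (Y : measurableType d) (encY : Y -> bitstream)
    (decY : bitstream -> Y) (P Q : probability Y R) :
  cancel encY decY -> measurable_fun setT encY -> measurable_fun setT decY ->
  (forall w, P (encY @^-1` cylinder w) = Q (encY @^-1` cylinder w)) ->
  forall S, measurable S -> P S = Q S.
Proof.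
move=> encYK me md PQ S mS.
have E (M : probability Y R) : M S = law M me (decY @^-1` S).
  by congr (M _); apply/seteqP; split => y /=; rewrite encYK.
rewrite !E; apply: bitstream_probability_unique => //.
by rewrite -[X in measurable X]setTI; exact: md.
Qed.

(** [p.1] codes a family of cylinder masses and [p.2] is the uniform variable. Decoding is total, so
    every code yields a probability, even if its family is not consistent. *)
Definition coded_pair (p : bitstream * R) : R * R :=
  dec2 R (random_bits (decode_family R p.1) p.2).

Lemma measurable_coded_pair : measurable_fun setT coded_pair.
Proof.
exact: (measurable_transfer_map (@measurable_dec2 R) (@measurable_decode_family R)).
Qed.

Lemma measurable_coded_pair_section k : measurable_fun setT (fun v => coded_pair (k, v)).
Proof. exact: (measurableT_comp measurable_coded_pair (pair1_measurable k)). Qed.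

Definition coded_law k : probability (R * R)%type R := law unif01 (measurable_coded_pair_section k).

(** [k] codes the masses that [gam], read through [enc2], gives to cylinders. Choosing a coupling
    thus becomes choosing a point of the Cantor space, along which one can project. *)
Lemma coded_law_surj (gam : probability (R * R)%type R) :
  exists k, forall S, measurable S -> gam S = coded_law k S.
Proof.
have mE w : measurable (@enc2 R @^-1` cylinder w : set (R * R)).
  by rewrite -[X in measurable X]setTI; apply: measurable_enc2 => //; exact: measurable_cylinder.
pose c w := fine (gam (@enc2 R @^-1` cylinder w)).
have cE w : (c w)%:E = gam (@enc2 R @^-1` cylinder w).
  by rewrite fineK// fin_num_measure.
have cc : consistent c.
  split => [|w|w].
  - by rewrite /c cylinder_nil preimage_setT probability_setT.
  - exact: fine_ge0.
  - apply: EFin_inj; rewrite EFinD !cE -measureU//.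
      congr (gam _); rewrite !cylinder_cons !preimage_setI -setIUr.
      rewrite (_ : _ `|` _ = setT) ?setIT//.
      by apply/seteqP; split => // y _ /=; case: (enc2 y (size w)); [right|left].
    by rewrite !cylinder_cons; apply/seteqP; split => // y [[_ /= ->] [_ ]].
have [k kc] := decode_family_surj c; exists k => S mS.
have mb : measurable_fun setT (fun v : R => random_bits (decode_family R k) v).
  exact: (measurableT_comp (measurable_random_bits (@measurable_decode_family R)) (pair1_measurable k)).
transitivity (law gam (@measurable_enc2 R) (@dec2 R @^-1` S)).
  by congr (gam _); apply/seteqP; split => y /=; rewrite enc2K.
transitivity (law unif01 mb (@dec2 R @^-1` S)); last by [].
apply: bitstream_probability_unique.
  move=> w; transitivity (c w)%:E; first by rewrite cE.
  by rewrite -(unif01_cylinder w cc) -kc.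
by rewrite -[X in measurable X]setTI; exact: measurable_dec2.
Qed.

End universal_parametrization.

Section almost_measurable_D_fgw.
Context (R : realType) (beta : R) (d1 : R -> R -> R).
Hypothesis md1 : measurable_fun [set: R * R] (fun p : R * R => d1 p.1 p.2).
Hypothesis beta01 : 0 <= beta <= 1.
Hypothesis d10 : forall x y, 0 <= d1 x y.
Local Open Scope ereal_scope.

Lemma measurable_coded_cost :
  measurable_fun setT (fun k : bitstream => fgw_cost beta d1 (coded_law R k) fst snd).
Proof.
have mc1 : measurable_fun setT (fun p : bitstream * R => (coded_pair p).1).
  exact: (measurableT_comp measurable_fst (@measurable_coded_pair R)).
have mc2 : measurable_fun setT (fun p : bitstream * R => (coded_pair p).2).
  exact: (measurableT_comp measurable_snd (@measurable_coded_pair R)).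
(* The dependence on [k] moves from the measure into the integrand, where Tonelli's theorem yields
   measurability in [k]. *)
rewrite [X in measurable_fun _ X](_ : _ = fun k =>
    (1 - beta)%:E * \int[unif01]_v (d1 (coded_pair (k, v)).1 (coded_pair (k, v)).2)%:E +
    beta%:E * \int[unif01]_v \int[unif01]_w ((d1 (coded_pair (k, v)).1 (coded_pair (k, w)).1 -
      d1 (coded_pair (k, v)).2 (coded_pair (k, w)).2) ^+ 2)%:E); last first.
  by apply/funext => k; rewrite /coded_law (fgw_cost_law beta md1 d10 unif01).
apply: emeasurable_funD; apply: measurable_funeM.
  have d0 (p : bitstream * R) : 0 <= (d1 (coded_pair p).1 (coded_pair p).2)%:E by rewrite lee_fin.
  exact: (measurable_fun_fubini_tonelli_F (m2 := unif01) _ (measurable_cost_linear md1 mc1 mc2) d0).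
pose h (q : (bitstream * R) * R) : \bar R := ((d1 (coded_pair (q.1.1, q.1.2)).1 (coded_pair (q.1.1, q.2)).1 -
      d1 (coded_pair (q.1.1, q.1.2)).2 (coded_pair (q.1.1, q.2)).2) ^+ 2)%:E.
have h0 q : 0 <= h q by rewrite lee_fin sqr_ge0.
have m11 : measurable_fun setT (fun q : (bitstream * R) * R => q.1.1) by exact: measurableT_comp.
have m12 : measurable_fun setT (fun q : (bitstream * R) * R => q.1.2) by exact: measurableT_comp.
have ma := measurable_fun_pair m11 m12.
have mb := measurable_fun_pair m11
  (@measurable_snd _ _ _ _ : measurable_fun setT (fun q : (bitstream * R) * R => q.2)).
have mh : measurable_fun setT h.
  have md u v : measurable_fun setT u -> measurable_fun setT v ->
      measurable_fun setT (fun q : (bitstream * R) * R => d1 (u q) (v q)).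
    by move=> mu mv; exact: (measurableT_comp md1 (measurable_fun_pair mu mv)).
  apply/measurable_EFinP; apply: measurable_funX; apply: measurable_funB; apply: md.
  - exact: (measurableT_comp mc1 ma).
  - exact: (measurableT_comp mc1 mb).
  - exact: (measurableT_comp mc2 ma).
  - exact: (measurableT_comp mc2 mb).
have mH := measurable_fun_fubini_tonelli_F (m2 := @unif01 R) _ mh h0.
have H0 p : 0 <= fubini_F (@unif01 R) h p by apply: integral_ge0.
exact: (measurable_fun_fubini_tonelli_F (m2 := @unif01 R) _ mH H0).
Qed.

Lemma measurable_coded_law (A : set (R * R)) : measurable A ->
  measurable_fun setT (fun k : bitstream => coded_law R k A).
Proof.
move=> mA.
have mp : measurable (@coded_pair R @^-1` A).
  by rewrite -[X in measurable X]setTI; exact: measurable_coded_pair.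
rewrite [X in measurable_fun _ X](_ : _ = unif01 \o xsection (@coded_pair R @^-1` A)).
  exact: measurable_fun_xsection.
by apply/funext => k; congr (unif01 _); apply/seteqP; split => v; rewrite /xsection /= inE.
Qed.

Lemma measurable_dotp (n : nat) : measurable_fun setT (fun p : n.-tuple R * n.-tuple R => dotp p.1 p.2).
Proof.
apply: measurable_sum => i; apply: measurable_funM.
  exact: (measurableT_comp (measurable_tnth i) measurable_fst).
exact: (measurableT_comp (measurable_tnth i) measurable_snd).
Qed.

Lemma measurable_dotp_section n (theta : n.-tuple R) : measurable_fun setT (fun x : n.-tuple R => dotp theta x).
Proof. exact: (measurableT_comp (@measurable_dotp n) (pair1_measurable theta)). Qed.

Lemma measurable_proj_push n (mu : probability (n.-tuple R) R) (A : set R) : measurable A ->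
  measurable_fun setT (fun theta : n.-tuple R => proj_push theta mu A).
Proof.
move=> mA.
have mp : measurable ((fun p : n.-tuple R * n.-tuple R => dotp p.1 p.2) @^-1` A).
  by rewrite -[X in measurable X]setTI; exact: measurable_dotp.
rewrite [X in measurable_fun _ X](_ : _ =
    mu \o xsection ((fun p : n.-tuple R * n.-tuple R => dotp p.1 p.2) @^-1` A)).
  exact: measurable_fun_xsection.
by apply/funext => x; congr (mu _); apply/seteqP; split => v; rewrite /xsection /= inE.
Qed.

Lemma almost_measurable_D_fgw n (m : {finite_measure set (n.-tuple R) -> \bar R})
    (mu nu : probability (n.-tuple R) R) :
  almost_measurable m (fun theta => D_fgw (proj_push theta mu) (proj_push theta nu) beta d1).
Proof.
apply: projection_almost_measurable => r.
pose C w : set R := @enc R @^-1` cylinder w.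
have mC w : measurable (C w).
  by rewrite -[X in measurable X]setTI; apply: measurable_enc => //; exact: measurable_cylinder.
pose W j := odflt [::] (unpickle j : option (seq bool)).
(* The marginals are prescribed only on the countable family [C w]. This keeps [B] measurable, and
   it suffices because these sets determine a probability on the line. *)
pose B : set (n.-tuple R * bitstream) := [set p |
  fgw_cost beta d1 (coded_law R p.2) fst snd < r%:E /\
  forall w, coded_law R p.2 (C w `*` setT) = proj_push p.1 mu (C w) /\
            coded_law R p.2 (setT `*` C w) = proj_push p.1 nu (C w)].
exists B.
  rewrite (_ : B = ([set: n.-tuple R * bitstream] `&`
      [set p | fgw_cost beta d1 (coded_law R p.2) fst snd < r%:E]) `&`
    \bigcap_j (([set: n.-tuple R * bitstream] `&`
      [set p | coded_law R p.2 (C (W j) `*` setT) = proj_push p.1 mu (C (W j))]) `&`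
      ([set: n.-tuple R * bitstream] `&`
      [set p | coded_law R p.2 (setT `*` C (W j)) = proj_push p.1 nu (C (W j))]))).
    have mcod A : measurable A -> measurable_fun setT
        (fun p : n.-tuple R * bitstream => coded_law R p.2 A).
      by move=> mA; exact: (measurableT_comp (measurable_coded_law mA) measurable_snd).
    have mpr (M : probability (n.-tuple R) R) A : measurable A -> measurable_fun setT
        (fun p : n.-tuple R * bitstream => proj_push p.1 M A).
      by move=> mA; exact: (measurableT_comp (measurable_proj_push M mA) measurable_fst).
    apply: measurableI.
      apply: measurable_lte => //.
      exact: (measurableT_comp measurable_coded_cost measurable_snd).
    apply: bigcapT_measurable => j; apply: measurableI.
      by apply: measurable_eqe; [exact: measurableT|apply: mcod; exact: measurableX|exact: mpr].
    by apply: measurable_eqe; [exact: measurableT|apply: mcod; exact: measurableX|exact: mpr].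
  apply/seteqP; split => [p [pr pC]|p [[_ pr] pC]].
    by split => // j _; split; split => //; case: (pC (W j)).
  split => // w; have := pC (pickle w) I.
  by rewrite /W pickleK /= => -[[_ ?] [_ ?]].
(* Because the inequality is strict, it holds exactly when some coupling costs less than [r],
   whether or not the infimum is attained. *)
apply/seteqP; split => [theta|_ [[theta k] [/= kr kC] <-] /=].
  rewrite /= D_fgwE => /ereal_inf_lt[_ [gam cp <-] gr].
  have [k kE] := coded_law_surj gam; exists (theta, k) => //; split => /=.
    by rewrite -(eq_fgw_cost _ _ _ _ kE).
  move=> w; have [<- <-] := cp _ (mC w).
  by split; apply/esym; apply: kE; exact: measurableX.
apply: le_lt_trans kr; apply: D_fgw_le => // A mA.
have law1 : forall S, measurable S -> law (coded_law R k) measurable_fst S =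
    law mu (measurable_dotp_section theta) S.
  apply: (encoded_probability_unique (@encK R) (@measurable_enc R) (@measurable_dec R)) => w.
  by apply: etrans (kC w).1; rewrite setXT.
have law2 : forall S, measurable S -> law (coded_law R k) measurable_snd S =
    law nu (measurable_dotp_section theta) S.
  apply: (encoded_probability_unique (@encK R) (@measurable_enc R) (@measurable_dec R)) => w.
  by apply: etrans (kC w).2; rewrite setTX.
by split; [exact: law1|exact: law2].
Qed.

End almost_measurable_D_fgw.

(** * The surface measure *)

Section surface.
Context (R : realType).
Local Open Scope ereal_scope.

Let ltN11 : (-1 < 1 :> R)%R. Proof. lra. Qed.

(* [lebesgue_measure] lives on [measurableTypeR R], whose display differs from that of [R]. *)
Let measurable_idR : measurable_fun setT (idfun : measurableTypeR R -> R).
Proof. by move=> _ A mA; rewrite setTI. Qed.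

Definition unif_N11 : probability R R := law (uniform_prob ltN11) measurable_idR.

Lemma integral_unif_N11 (F : R -> \bar R) : measurable_fun setT F -> (forall x, 0 <= F x) ->
  (forall x, (1 < `|x|)%R -> F x = 0) ->
  \int[lebesgue_measure]_x F x = 2%:E * \int[unif_N11]_x F x.
Proof.
move=> mF F0 Fout; rewrite (ge0_integral_law _ measurable_idR mF F0).
rewrite (integral_uniform ltN11 (measurableT_comp mF measurable_idR))//.
rewrite muleA -EFinM (_ : 2 * _ = 1)%R ?mul1e; last by rewrite opprK -(natrD _ 1 1) divff.
rewrite [RHS]integral_mkcond; apply: eq_integral => x _.
rewrite patchE; case: ifPn => //; rewrite notin_setE /= in_itv /= => /negP.
by rewrite -ler_norml -ltNge => /Fout.
Qed.

(* [P] is the uniform probability on the cube [-1, 1]^n. *)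
Lemma leb_iter_cube n : exists P : probability (n.-tuple R) R,
  forall F : n.-tuple R -> \bar R, measurable_fun setT F -> (forall x, 0 <= F x) ->
  (forall x, (exists i, (1 < `|tnth x i|)%R) -> F x = 0) ->
  leb_iter F = (2 ^+ n)%:E * \int[P]_x F x.
Proof.
elim: n => [|n [P HP]].
  exists (\d_([tuple] : 0.-tuple R)) => F mF F0 _ /=.
  by rewrite integral_dirac// diracT expr0 !mul1e.
have mc : measurable_fun setT (fun p : R * n.-tuple R => [tuple of p.1 :: p.2]).
  exact: (measurable_cons measurable_fst measurable_snd).
exists (law (unif_N11 \x P) mc) => F mF F0 Fout /=.
have mFc := measurableT_comp mF mc.
have Fc0 (p : R * n.-tuple R) : 0 <= F [tuple of p.1 :: p.2] by [].
rewrite (ge0_integral_law _ mc mF F0) fubini_tonelli1//.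
rewrite /fubini_F /=.
transitivity (\int[lebesgue_measure]_x ((2 ^+ n)%:E * \int[P]_t F [tuple of x :: t])).
  apply: eq_integral => x _; apply: HP => //.
    exact: (measurableT_comp mFc (pair1_measurable x)).
  move=> t [i ti]; apply: Fout; exists (lift ord0 i).
  by rewrite tnthS.
have mI : measurable_fun setT (fun x : R => \int[P]_t F [tuple of x :: t]).
  exact: (measurable_fun_fubini_tonelli_F (m2 := P) _ mFc Fc0).
have I0 (x : R) : 0 <= \int[P]_t F [tuple of x :: t] by apply: integral_ge0.
rewrite integral_unif_N11.
- rewrite ge0_integralZl_EFin; [|exact: measurableT|by move=> x _; exact: I0|exact: mI|exact: exprn_ge0].
  by rewrite muleA -EFinM -exprS.
- exact: measurable_funeM mI.
- by move=> x; apply: mule_ge0 => //; rewrite lee_fin exprn_ge0.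
- move=> x x1; rewrite integral0_eq ?mule0// => t _.
  by apply: Fout; exists ord0.
Qed.

Lemma measurable_enorm n : measurable_fun setT (@enorm R n).
Proof.
apply: (measurableT_comp (f := @Num.sqrt R)).
  by apply: continuous_measurable_fun; exact: sqrt_continuous.
exact: (measurableT_comp (@measurable_dotp R n)
  (measurable_fun_pair (@measurable_id _ _ _) (@measurable_id _ _ _))).
Qed.

Lemma enorm_tscale n (t : R) (x : n.-tuple R) : (0 <= t)%R -> enorm (tscale t x) = (t * enorm x)%R.
Proof.
move=> t0; rewrite /enorm (_ : dotp _ _ = t ^+ 2 * dotp x x)%R.
  by rewrite sqrtrM ?sqr_ge0// sqrtr_sqr ger0_norm.
rewrite /dotp mulr_sumr; apply: eq_bigr => i _.
by rewrite !tnth_map; ring.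
Qed.

Lemma enorm_coordinate n (x : n.-tuple R) i : (`|tnth x i| <= enorm x)%R.
Proof.
rewrite -sqrtr_sqr /enorm; apply: ler_wsqrtr; rewrite /dotp (bigD1 i)//= -expr2 lerDl.
by apply: sumr_ge0 => j _; rewrite -expr2 sqr_ge0.
Qed.

Definition normalize n (x : n.-tuple R) : n.-tuple R := tscale (enorm x)^-1 x.

Lemma measurable_normalize n : measurable_fun setT (@normalize n).
Proof.
apply/measurable_fun_tnthP => i.
rewrite (_ : _ \o _ = fun x : n.-tuple R => (enorm x)^-1 * tnth x i)%R; last first.
  by apply/funext => x /=; rewrite tnth_map.
apply: measurable_funM; last exact: measurable_tnth.
rewrite (_ : (fun x => _) = fun x : n.-tuple R => enorm x `^ (-1))%R; last first.
  by apply/funext => x; rewrite powR_inv1// sqrtr_ge0.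
exact: (measurableT_comp (@measurable_powR R (-1)%R) (@measurable_enorm n)).
Qed.

Definition punctured_ball n : set (n.-tuple R) := [set x | 0 < enorm x <= 1]%R.

Lemma measurable_punctured_ball n : measurable (@punctured_ball n).
Proof.
rewrite (_ : @punctured_ball n = @enorm R n @^-1` `]0%R, 1%R]); last first.
  by apply/seteqP; split => x; rewrite /punctured_ball /= in_itv.
by rewrite -[X in measurable X]setTI; exact: measurable_enorm.
Qed.

(** Polar coordinates: [t] is the norm of [y] and [x] its direction; [0 < t] excludes the origin. *)
Lemma cone_over n (A : set (n.-tuple R)) :
  [set y | exists (t : R) (x : n.-tuple R),
     (0 < t <= 1)%R /\ (A `&` @sphere R n) x /\ y = tscale t x] =
  @punctured_ball n `&` @normalize n @^-1` A.
Proof.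
apply/seteqP; split => [_ [t [x [/andP[t0 t1] [[Ax x1] ->]]]]|y [/andP[y0 y1] Ay]].
  have tx : enorm (tscale t x) = t by rewrite enorm_tscale ?ltW// x1 mulr1.
  split; first by rewrite /punctured_ball /= tx t0.
  rewrite /normalize /= tx (_ : tscale _ _ = x)//.
  by apply: eq_from_tnth => i; rewrite !tnth_map mulKf// gt_eqF.
exists (enorm y), (normalize y); split; first by rewrite y0.
split; first split => //.
  by rewrite /sphere /= enorm_tscale ?invr_ge0 1?ltW// mulVf// gt_eqF.
by apply: eq_from_tnth => i; rewrite !tnth_map mulVKf// gt_eqF.
Qed.

(** Countable additivity is not built into the iterated integral [lebesgue_nd]. But the cone over
    [A] lies in the cube, so its volume is [2 ^+ n] times a probability, and in terms of [A] this is
    a slice of the law of [(normalize x, x)] over the punctured ball. *)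
Lemma surface_measureE n : exists m : {finite_measure set (n.-tuple R) -> \bar R},
  forall A, measurable A -> surface_measure A = m A.
Proof.
have [P HP] := leb_iter_cube n.
have mN := measurable_fun_pair (@measurable_normalize n) (@measurable_id _ _ setT).
have c0 : (0 <= n%:R * 2 ^+ n :> R)%R by rewrite mulr_ge0// exprn_ge0.
exists (mscale (NngNum c0) (slice_measure (law P mN) (@measurable_punctured_ball n))) => A mA.
rewrite /surface_measure cone_over /lebesgue_nd.
have mS : measurable (@punctured_ball n `&` @normalize n @^-1` A).
  apply: measurableI; first exact: measurable_punctured_ball.
  by rewrite -[X in measurable X]setTI; exact: measurable_normalize.
rewrite HP.
- rewrite integral_indic// setIT muleA -EFinM; congr (_ * P _).
  by apply/seteqP; split => x /=; tauto.
- by apply/measurable_EFinP; exact: measurable_indic.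
- by move=> x; rewrite lee_fin.
- move=> x [i xi]; rewrite indicE memNset// => -[/andP[_ x1] _].
  by have := enorm_coordinate x i; rewrite leNgt (le_lt_trans x1 xi).
Qed.

Lemma measurable_sphere n : measurable (@sphere R n).
Proof.
rewrite (_ : @sphere R n = @enorm R n @^-1` [set 1%R]) // -[X in measurable X]setTI.
exact: measurable_enorm.
Qed.

Lemma Gamma_ge0 (s : R) : (0 <= Gamma s)%R.
Proof. by apply: fine_ge0; apply: integral_ge0 => t _; rewrite lee_fin mulr_ge0 ?powR_ge0 ?expR_ge0. Qed.

Lemma besselI_ge0 (v x : R) : (0 <= besselI v x)%R.
Proof.
rewrite /besselI; set u := fun n => _.
have u0 n : (0 <= u n)%R.
  apply: sumr_ge0 => m _; rewrite mulr_ge0 ?powR_ge0// invr_ge0 mulr_ge0//.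
  exact: Gamma_ge0.
(* If the partial sums diverge, the limit is the default value 0. *)
have [cu|ncu] := pselect (cvgn u); last by rewrite dvgP.
by apply: limr_ge => //; exact: nearW.
Qed.

Lemma vMF_const_ge0 n (kappa : R) : (0 <= vMF_const n kappa)%R.
Proof.
rewrite /vMF_const mulr_ge0 ?powR_ge0// invr_ge0 mulr_ge0 ?powR_ge0//.
exact: besselI_ge0.
Qed.

End surface.

(** * The spherical sliced discrepancy *)

Section vMF_expect.
Context (R : realType) (n : nat).
Local Open Scope ereal_scope.
Implicit Types (eps : n.-tuple R) (kappa : R) (f g h : n.-tuple R -> \bar R).

Lemma vMF_expect_ge0 eps kappa f : (forall x, 0 <= f x) -> 0 <= vMF_expect eps kappa f.
Proof.
move=> f0; have [m mE] := @surface_measureE R n.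
rewrite /vMF_expect (eq_integral_set_function _ _ mE).
by apply: integral_ge0 => x _; rewrite mule_ge0// lee_fin mulr_ge0 ?vMF_const_ge0 ?expR_ge0.
Qed.

(** All three functions are set to 0 on a common null set, which changes no integral and makes them
    measurable, so that additivity applies. Almost measurability is asked for every finite [m]
    because [surface_measureE] gives the measure only existentially. *)
Lemma le_vMF_expect_add eps kappa f g h (K : R) :
  (forall m : {finite_measure set (n.-tuple R) -> \bar R},
    [/\ almost_measurable m f, almost_measurable m g & almost_measurable m h]) ->
  (forall x, 0 <= f x) -> (forall x, 0 <= g x) -> (forall x, 0 <= h x) -> (0 <= K)%R ->
  (forall x, h x <= K%:E * (f x + g x)) ->
  vMF_expect eps kappa h <= K%:E * (vMF_expect eps kappa f + vMF_expect eps kappa g).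
Proof.
move=> am f0 g0 h0 K0 hfg; have [m mE] := @surface_measureE R n.
rewrite /vMF_expect !(eq_integral_set_function _ _ mE).
have [/almost_measurable_patch[Nf [mNf Nf0 mf]] /almost_measurable_patch[Ng [mNg Ng0 mg]]
  /almost_measurable_patch[Nh [mNh Nh0 mh]]] := am m.
pose N := Nf `|` (Ng `|` Nh).
have mN : measurable N by do 2!apply: measurableU => //.
have N0 : m N = 0.
  apply: (@measure_negligible _ _ _ m) => //.
  apply: negligibleU; first by exists Nf; split.
  by apply: negligibleU; [exists Ng|exists Nh]; split.
have {}mf : measurable_fun setT (f \_ (~` N)) by apply: mf => // x; left.
have {}mg : measurable_fun setT (g \_ (~` N)) by apply: mg => // x; right; left.
have {}mh : measurable_fun setT (h \_ (~` N)) by apply: mh => // x; right; right.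
pose w x := (vMF_const n kappa * expR (kappa * dotp eps x))%R.
have w0 x : (0 <= w x)%R by rewrite mulr_ge0 ?vMF_const_ge0 ?expR_ge0.
have mw : measurable_fun setT (fun x => (w x)%:E).
  apply/measurable_EFinP; apply: measurable_funM; first exact: measurable_cst.
  apply: (measurableT_comp (@measurable_expR R)); apply: measurable_funM; first exact: measurable_cst.
  exact: measurable_dotp_section.
pose u F x := (w x)%:E * (F \_ (~` N)) x.
have uE F : (fun x => (w x)%:E * F x) \_ (~` N) = u F.
  by apply/funext => x; rewrite /u !patchE; case: ifP => //; rewrite mule0.
have F0 F : (forall x, 0 <= F x) -> forall x, 0 <= u F x.
  by move=> F0 x; rewrite /u mule_ge0 ?lee_fin// patchE; case: ifP.
have mu F : measurable_fun setT (F \_ (~` N)) -> measurable_fun setT (u F).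
  by move=> mF; exact: emeasurable_funM.
have intE F : (forall x, 0 <= F x) -> measurable_fun setT (F \_ (~` N)) ->
    \int[m]_(x in @sphere R n) ((w x)%:E * F x) = \int[m]_(x in @sphere R n) u F x.
  move=> FF0 mF; rewrite (ge0_integral_patch_null (N := N))//.
  - by rewrite uE.
  - exact: measurable_sphere.
  - by move=> x; rewrite mule_ge0// lee_fin.
  - by rewrite uE; exact: mu.
have mS := @measurable_sphere R n.
rewrite (intE h h0 mh) (intE f f0 mf) (intE g g0 mg) -ge0_integralD//; last 4 first.
- by move=> x _; exact: F0.
- by apply: measurable_funTS; exact: mu.
- by move=> x _; exact: F0.
- by apply: measurable_funTS; exact: mu.
rewrite -ge0_integralZl_EFin//; last 2 first.
- by move=> x _; apply: adde_ge0; exact: F0.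
- by apply: measurable_funTS; apply: emeasurable_funD; exact: mu.
apply: ge0_le_integral => //.
- by move=> x _; exact: F0.
- by apply: measurable_funTS; exact: mu.
- by apply: measurable_funTS; apply: measurable_funeM; apply: emeasurable_funD; exact: mu.
- move=> x _; rewrite /u !patchE; case: ifP => _; last by rewrite !mule0 adde0 mule0.
  by rewrite -ge0_muleDr// muleCA lee_wpmul2l// lee_fin.
Qed.

End vMF_expect.

Lemma sphere_neq0 (R : realType) n : (0 < n)%N -> @sphere R n !=set0.
Proof.
case: n => // n _; exists [tuple (i == ord0)%:R | i < n.+1].
rewrite /sphere /= /enorm /dotp (bigD1 ord0)//= big1 ?addr0.
  by rewrite !tnth_mktuple eqxx mulr1 sqrtr1.
by move=> i i0; rewrite !tnth_mktuple (negbTE i0) mul0r.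
Qed.

Unset Implicit Arguments.

Theorem theorem1 (R : realType) (d : nat) (beta kappa : R) (d1 : R -> R -> R) :
  (2 <= d)%N -> 0 <= beta <= 1 -> 0 < kappa ->
  pseudo_metric d1 ->
  measurable_fun [set: R * R] (fun p : R * R => d1 p.1 p.2) ->
  [/\ (forall mu nu : probability (d.-tuple R) R,
         finite_moments mu -> finite_moments nu ->
         (0 <= SSFG mu nu beta kappa d1)%E),
      (forall mu nu : probability (d.-tuple R) R,
         finite_moments mu -> finite_moments nu ->
         SSFG mu nu beta kappa d1 = SSFG nu mu beta kappa d1) &
      exists C' : R, 0 < C' /\
        forall mu nu xi : probability (d.-tuple R) R,
          finite_moments mu -> finite_moments nu -> finite_moments xi ->
          (SSFG mu xi beta kappa d1
             <= C'%:E * (SSFG mu nu beta kappa d1 + SSFG nu xi beta kappa d1))%E].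
Proof.
move=> d2 beta01 _ [d10 d1C [C [C0 tri]]] md1; split.
- move=> mu nu _ _; have [eps Seps] := @sphere_neq0 R d (ltnW d2).
  (* The supremum dominates the expectation at any one location, and the sphere has a point. *)
  apply: le_trans (ereal_sup_ubound _); last by exists eps; [exact: Seps|reflexivity].
  by apply: vMF_expect_ge0 => theta; exact: D_fgw_ge0.
- move=> mu nu _ _; rewrite /SSFG; congr ereal_sup; congr image.
  apply/funext => eps; congr vMF_expect; apply/funext => theta.
  exact: D_fgwC.
- pose K := Num.max C 2; have K2 : 2 <= K by rewrite le_max lexx orbT.
  have K0 : 0 < K by exact: lt_le_trans K2.
  have triK x y z : d1 x z <= K * (d1 x y + d1 y z).
    apply: le_trans (tri x y z) _; apply: ler_wpM2r; first exact: addr_ge0.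
    by rewrite le_max lexx.
  exists K; split => // mu nu xi _ _ _.
  (* The constant does not depend on the location [eps], so it is enough to bound each expectation;
     those on the right are then at most their own suprema. *)
  apply: ge_ereal_sup => _ [eps Seps <-].
  apply: (@le_trans _ _ (K%:E * (
    vMF_expect eps kappa (fun theta => D_fgw (proj_push theta mu) (proj_push theta nu) beta d1) +
    vMF_expect eps kappa (fun theta => D_fgw (proj_push theta nu) (proj_push theta xi) beta d1)))%E).
    apply: le_vMF_expect_add.
    + by move=> m; split; exact: almost_measurable_D_fgw.
    + by move=> theta; exact: D_fgw_ge0.
    + by move=> theta; exact: D_fgw_ge0.
    + by move=> theta; exact: D_fgw_ge0.
    + exact: ltW.
    + by move=> theta; exact: D_fgw_triangle.
  apply: lee_wpmul2l; first by rewrite lee_fin ltW.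
  by apply: leeD; apply: ereal_sup_ubound; exists eps.
Qed.
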